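(* Let $K\subset\mathbb{R}^n$ be a compact convex set whose interior contains the origin, with gauge function $\gamma$, and let $\gamma^\circ$ be the gauge function of the polar $K^\circ$. Let $U\subset\mathbb{R}^n$ be a bounded open set such that $\partial U$ is $C^{k,\alpha}$, where $k\ge 1$ is an integer and $0\le\alpha\le 1$, and let $\nu$ be the inward unit normal to $\partial U$. Let $\rho(x)=\min_{y\in\partial U}\gamma(x-y)$. Let $y_0\in\partial U$ and suppose there is $x_0\in U$ such that $y_0$ is the unique $\rho$-closest point on $\partial U$ to $x_0$. Furthermore, suppose that $\nu_0=\nu(y_0)$ is an interior point of the normal cone $N\big(K,\tfrac{x_0-y_0}{\rho(x_0)}\big)$. Then there is an open ball $B_r(y_0)$ such that $\rho$ is $C^{k,\alpha}$ on $\overline U\cap B_r(y_0)$. In addition, every $y\in\partial U\cap B_r(y_0)$ is the unique $\rho$-closest point on $\partial U$ to some points in $U$. Moreover, for every $y\in\partial U\cap B_r(y_0)$, $$D\rho(y)=\mu(y)=\frac{\nu(y)}{\gamma^\circ(\nu(y))}.$$ Furthermore, when $k\ge 2$, for every $y\in\partial U\cap B_r(y_0)$, with $\nu=\nu(y)$ and $X=X(\nu)$, $$D^2\rho(y)=\frac{1}{\gamma^\circ(\nu)}(I-X^{T})\,D^2d(y)\,(I-X),$$ where $d(\cdot):=\min_{z\in\partial U}|\cdot-z|$ is the Euclidean distance to $\partial U$.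
   Context: The gauge function of a compact convex set $K$ with $0\in\mathrm{int}(K)$ is $\gamma(x)=\inf\{\lambda>0:\tfrac1\lambda x\in K\}$ (it need not be symmetric). The polar is $K^\circ=\{x:\langle x,y\rangle\le 1\text{ for all }y\in K\}$, again a compact convex set with $0$ in its interior; $\gamma^\circ$ is its gauge function. For $x\in\partial K$, the normal cone is $N(K,x)=\{v\in\mathbb{R}^n:\langle y-x,v\rangle\le 0\text{ for all }y\in K\}$. A point $y\in\partial U$ is called a $\rho$-closest point to $x$ on $\partial U$ if $\rho(x)=\gamma(x-y)$. For vectors $a,b$, $a\otimes b$ is the matrix acting by $(a\otimes b)z=\langle z,b\rangle a$. When $\gamma^\circ$ is differentiable at $v\neq 0$ (as it is at $\nu(y)$ for the points $y$ in the formula for $D^2\rho$), $X(v):=\frac{1}{\gamma^\circ(v)}D\gamma^\circ(v)\otimes v$. $I$ is the $n\times n$ identity matrix. $|\cdot|$ is the Euclidean norm. ''$\rho$ is $C^{k,\alpha}$ on $\overline U\cap B_r(y_0)$'' means regularity up to the boundary: the restriction of $\rho$ to $\overline U\cap B_r(y_0)$ extends to a $C^{k,\alpha}$ function on $B_r(y_0)$; $D\rho(y)$ and $D^2\rho(y)$ at $y\in\partial U$ are the corresponding derivatives from inside $U$. (As a function on all of $\mathbb{R}^n$, $\rho$ is not differentiable on $\partial U$.) Likewise, $D^2d(y)$ for $y\in\partial U$ is understood for $d$ as a function on $\overline U$ near $\partial U$, where $Dd=\nu$ on $\partial U$; thus $Dd$ is a $C^{k-1,\alpha}$ extension of $\nu$.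 *)

(* Defs.v *)
(* R^n is 'rV[R]_n for R : realType. *)
From mathcomp Require Import all_boot all_order all_algebra.
From mathcomp Require Import all_classical all_reals all_analysis.

Set Implicit Arguments.
Unset Strict Implicit.
Unset Printing Implicit Defensive.

Import Order.TTheory GRing.Theory Num.Theory.
Import numFieldNormedType.Exports.

Local Open Scope classical_set_scope.
Local Open Scope ring_scope.

(* The library norm `|x| on 'rV[R]_n is the sup norm. It induces the usual
   topology; wherever the metric itself matters, enorm and eball are used. *)
Definition dotv (R : realType) (n : nat) (x y : 'rV[R]_n) : R :=
  \sum_(i < n) x 0 i * y 0 i.

Definition enorm (R : realType) (n : nat) (x : 'rV[R]_n) : R :=
  Num.sqrt (dotv x x).

Definition eball (R : realType) (n : nat) (x : 'rV[R]_n) (r : R)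
    : set 'rV[R]_n :=
  [set z | enorm (z - x) < r].

Definition bdry (R : realType) (n : nat) (U : set 'rV[R]_n) : set 'rV[R]_n :=
  closure U `\` interior U.

Definition gauge_fun (R : realType) (n : nat) (K : set 'rV[R]_n) (x : 'rV[R]_n)
    : R :=
  inf [set l : R | 0 < l /\ K (l^-1 *: x)].

Definition polar (R : realType) (n : nat) (K : set 'rV[R]_n)
    : set 'rV[R]_n :=
  [set x | forall y, K y -> dotv x y <= 1].

Definition normal_cone (R : realType) (n : nat) (K : set 'rV[R]_n)
    (x : 'rV[R]_n) : set 'rV[R]_n :=
  [set v | forall y, K y -> dotv (y - x) v <= 0].

(* When U is bounded, open and nonempty, bdry U is compact and nonempty, and
   the infima in rho_fun and bdry_dist are minima. *)
Definition rho_fun (R : realType) (n : nat) (K U : set 'rV[R]_n) (x : 'rV[R]_n)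
    : R :=
  inf [set gauge_fun K (x - y) | y in bdry U].

Definition bdry_dist (R : realType) (n : nat) (U : set 'rV[R]_n) (x : 'rV[R]_n)
    : R :=
  inf [set enorm (x - z) | z in bdry U].

Definition closest (R : realType) (n : nat) (K U : set 'rV[R]_n)
    (x y : 'rV[R]_n) : Prop :=
  bdry U y /\ rho_fun K U x = gauge_fun K (x - y).

Definition unique_closest (R : realType) (n : nat) (K U : set 'rV[R]_n)
    (x y : 'rV[R]_n) : Prop :=
  closest K U x y /\ forall z, closest K U x z -> z = y.

Definition pderiv (R : realType) (n : nat) (i : 'I_n) (f : 'rV[R]_n -> R)
    : 'rV[R]_n -> R :=
  fun x => 'D_(delta_mx 0 i) f x.

Definition grad (R : realType) (n : nat) (f : 'rV[R]_n -> R) (x : 'rV[R]_n)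
    : 'rV[R]_n :=
  \row_(i < n) pderiv i f x.

Definition hess (R : realType) (n : nat) (f : 'rV[R]_n -> R) (x : 'rV[R]_n)
    : 'M[R]_n :=
  \matrix_(i < n, j < n) pderiv j (pderiv i f) x.

(* f is C^{k,alpha} on A, for A open: all partial derivatives of order <= k
   exist and are continuous on A and, when 0 < alpha, those of order k are
   Hoelder continuous on A with exponent alpha. Thus C^{k,0} is C^k. *)
Fixpoint holder_class (R : realType) (n : nat) (k : nat) (alpha : R)
    (A : set 'rV[R]_n) (f : 'rV[R]_n -> R) : Prop :=
  {in A, continuous f} /\
  match k with
  | 0%N => 0 < alpha ->
      exists C : R, forall x y, A x -> A y ->
        `|f x - f y| <= C * enorm (x - y) `^ alpha
  | k'.+1 => forall i : 'I_n,
      (forall x, A x -> derivable f x (delta_mx 0 i)) /\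
      holder_class k' alpha A (pderiv i f)
  end.

(* Near each boundary point, U is the strict epigraph, in the direction of a
   unit vector e, of a C^{k,alpha} function on the hyperplane orthogonal to e.
   That function is represented by its composition g with the orthogonal
   projection, i.e. by a function on R^n invariant under translation along e. *)
Definition boundary_class (R : realType) (n : nat) (k : nat) (alpha : R)
    (U : set 'rV[R]_n) : Prop :=
  forall y, bdry U y ->
    exists (r : R) (e : 'rV[R]_n) (g : 'rV[R]_n -> R),
      [/\ 0 < r,
          enorm e = 1,
          forall (x : 'rV[R]_n) (t : R), g (x + t *: e) = g x,
          holder_class k alpha (eball y r) g &
          forall x, eball y r x -> (U x <-> g x < dotv x e)].

(* Velocities at y of differentiable curves running in the boundary of U. *)
Definition tangent_vector (R : realType) (n : nat) (U : set 'rV[R]_n)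
    (y tau : 'rV[R]_n) : Prop :=
  exists c : R -> 'rV[R]_n,
    [/\ c 0 = y, \forall t \near 0, bdry U (c t) & is_derive (0 : R) (1 : R) c tau].

Definition inward_unit_normal (R : realType) (n : nat) (U : set 'rV[R]_n)
    (y v : 'rV[R]_n) : Prop :=
  [/\ enorm v = 1,
      forall tau, tangent_vector U y tau -> dotv tau v = 0 &
      \forall t \near (0 : R)^'+, U (y + t *: v)].

(* f is C^{k,alpha} up to the boundary on the part of closure U inside B. *)
Definition holder_class_closure (R : realType) (n : nat) (k : nat) (alpha : R)
    (U B : set 'rV[R]_n) (f : 'rV[R]_n -> R) : Prop :=
  exists g : 'rV[R]_n -> R,
    holder_class k alpha B g /\ forall x, closure U x -> B x -> g x = f x.

(* First and second derivatives at y of f from inside U: those of a C^1, resp.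
   C^2, function defined around y that agrees with f on closure U. For y in
   closure U with U open they do not depend on the extension chosen. *)
Definition is_inner_grad (R : realType) (n : nat) (U : set 'rV[R]_n)
    (f : 'rV[R]_n -> R) (y v : 'rV[R]_n) : Prop :=
  exists (r : R) (g : 'rV[R]_n -> R),
    [/\ 0 < r, holder_class 1 0 (eball y r) g,
        forall x, closure U x -> eball y r x -> g x = f x &
        grad g y = v].

Definition is_inner_hess (R : realType) (n : nat) (U : set 'rV[R]_n)
    (f : 'rV[R]_n -> R) (y : 'rV[R]_n) (H : 'M[R]_n) : Prop :=
  exists (r : R) (g : 'rV[R]_n -> R),
    [/\ 0 < r, holder_class 2 0 (eball y r) g,
        forall x, closure U x -> eball y r x -> g x = f x &
        hess g y = H].

(* Matrices act on column vectors: (tensor a b) *m z^T = (dotv z b) *: a^T. *)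
Definition tensor (R : realType) (n : nat) (a b : 'rV[R]_n) : 'M[R]_n :=
  a^T *m b.

Definition Xmat (R : realType) (n : nat) (K : set 'rV[R]_n) (v : 'rV[R]_n)
    : 'M[R]_n :=
  (gauge_fun (polar K) v)^-1 *: tensor (grad (gauge_fun (polar K)) v) v.

(* Main.v *)
Require Import Defs.
From HB Require Import structures.
From mathcomp Require Import all_boot all_order all_algebra.
From mathcomp Require Import all_classical all_reals all_analysis.
From mathcomp Require Import ring lra.

(** Write p = (x0 - y0) / rho(x0), a point of K.  Since nu(y0) is interior to
the normal cone of K at p, so are all vectors v near nu(y0); for them
gamma^o(v) = <p, v>, and K has a corner at p.  The consequence is that near y0
the shortest rays all have the same direction: for x in the closure of U close
to y0, rho(x) is the time tau(x) needed to go back from x to the boundary in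
direction -p.

Let U = {F > 0} near y0, with F of class C^(k,alpha) and DF a positive
multiple of nu on the boundary.  As <p, DF> > 0, the equation
F(x - tau(x) p) = 0 determines tau ([implicit_shift]), and
Dtau = DF / <p, DF> at x - tau(x) p, so that tau gains regularity up to that of
F ([germ_implicit]); at a boundary point Dtau = nu / <p, nu> = nu / gamma^o(nu).
That rho = tau, with x - tau(x) p the only closest point, is [rho_local].  For
z in the boundary near y0 and y' = x - tau(x) p, a mean value of DF yields a
vector w in the normal cone with <y' - z, w> = |y' - z|^2 ([strict_support]),
and then gamma(x - z) <p, w> >= <x - z, w> = |y' - z|^2 + tau(x) <p, w>.
Points z far from y0 are excluded by compactness of K.  A boundary point y is
the closest point to y + t p for small t ([unique_closest_near]).

For the second derivatives, the Euclidean distance is treated in the same way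
with normal rays.  The map that sends (z, t), z in the boundary, to
z + t nu(z) is written in the coordinates of [implicit_shift] for the direction
nu(y), where its derivative at y is the identity; its inverse is C^1
([local_inverse_C1]), and the resulting time coordinate g has the C^1 unit
gradient nu at the foot point ([signed_distance]).  Thus g is C^2; being
1-Lipschitz and zero on the boundary it equals d on the closure of U
([bdry_dist_local]).  Finally g(x - tau(x) p) = 0 for all x near y; two
differentiations of this identity at y give the formula for D^2 rho
([hess_shift]), with Dtau = nu / <p, nu> and X = p nu^T / <p, nu>.

All smoothness is handled through strict differentiability, where
f(x) - f(x') = <x - x', W(x, x')> with W continuous at the diagonal point.  It
is the form in which increments along the boundary, implicit functions and
inverse maps can be computed by solving linear equations for W. *)

Import Order.TTheory GRing.Theory Num.Theory.
Import numFieldNormedType.Exports.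

Set Implicit Arguments.
Unset Strict Implicit.
Unset Printing Implicit Defensive.

Local Open Scope classical_set_scope.
Local Open Scope ring_scope.

(** * Vectors, matrices and their limits *)

Section Vectors.
Context {R : realType}.

Section Dot.
Context {n : nat}.
Implicit Types x y z : 'rV[R]_n.

Lemma dotvC x y : dotv x y = dotv y x.
Proof. by apply: eq_bigr => i _; rewrite mulrC. Qed.

Lemma dotvDl x y z : dotv (x + y) z = dotv x z + dotv y z.
Proof. by rewrite -big_split; apply: eq_bigr => i _; rewrite mxE mulrDl. Qed.

Lemma dotvZl a x z : dotv (a *: x) z = a * dotv x z.
Proof. by rewrite mulr_sumr; apply: eq_bigr => i _; rewrite mxE mulrA. Qed.

Lemma dotvNl x z : dotv (- x) z = - dotv x z.
Proof. by rewrite -scaleN1r dotvZl mulN1r. Qed.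

Lemma dotvBl x y z : dotv (x - y) z = dotv x z - dotv y z.
Proof. by rewrite dotvDl dotvNl. Qed.

Lemma dotvDr x y z : dotv z (x + y) = dotv z x + dotv z y.
Proof. by rewrite dotvC dotvDl !(dotvC z). Qed.

Lemma dotvZr a x z : dotv z (a *: x) = a * dotv z x.
Proof. by rewrite dotvC dotvZl (dotvC z). Qed.

Lemma dotvNr x z : dotv z (- x) = - dotv z x.
Proof. by rewrite dotvC dotvNl (dotvC z). Qed.

Lemma dotvBr x y z : dotv z (x - y) = dotv z x - dotv z y.
Proof. by rewrite dotvDr dotvNr. Qed.

Lemma dot0v z : dotv 0 z = 0.
Proof. by rewrite -(scale0r 0) dotvZl mul0r. Qed.

Lemma dotv0 z : dotv z 0 = 0.
Proof. by rewrite dotvC dot0v. Qed.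

Lemma dotv_delta i y : dotv (delta_mx 0 i) y = y 0 i.
Proof.
rewrite /dotv (bigD1 i) //= big1 ?addr0 => [|j ji].
  by rewrite mxE !eqxx mul1r.
by rewrite mxE (negbTE ji) andbF mul0r.
Qed.

Lemma dotvv_ge0 x : 0 <= dotv x x.
Proof. by apply: sumr_ge0 => i _; rewrite -expr2 sqr_ge0. Qed.

Lemma dotvv_eq0 x : (dotv x x == 0) = (x == 0).
Proof.
apply/idP/eqP => [|->]; last by rewrite dot0v.
rewrite psumr_eq0 => [/allP xx0|i _]; last by rewrite -expr2 sqr_ge0.
apply/rowP => i; rewrite mxE; apply/eqP.
by have := xx0 i (mem_index_enum _); rewrite mulf_eq0 orbb.
Qed.

Lemma dotvv_gt0 x : (0 < dotv x x) = (x != 0).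
Proof. by rewrite lt_def dotvv_eq0 dotvv_ge0 andbT. Qed.

Lemma enorm_ge0 x : 0 <= enorm x.
Proof. exact: sqrtr_ge0. Qed.

Lemma sqr_enorm x : enorm x ^+ 2 = dotv x x.
Proof. by rewrite sqr_sqrtr// dotvv_ge0. Qed.

Lemma enormZ a x : enorm (a *: x) = `|a| * enorm x.
Proof.
by rewrite /enorm dotvZl dotvZr mulrA -expr2 sqrtrM ?sqr_ge0// sqrtr_sqr.
Qed.

Lemma dotv_le_unit x u : enorm u = 1 -> dotv x u <= enorm x.
Proof.
move=> u1; have uu : dotv u u = 1 by rewrite -sqr_enorm u1 expr1n.
(* the component of x orthogonal to u has nonnegative square *)
have := dotvv_ge0 (x - dotv x u *: u).
rewrite !(dotvBl, dotvBr, dotvZl, dotvZr) uu (dotvC u x) -sqr_enorm => h.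
have h2 : dotv x u ^+ 2 <= enorm x ^+ 2 by nra.
apply: le_trans (ler_norm _) _.
by rewrite -ler_sqr ?nnegrE ?enorm_ge0// real_normK ?num_real.
Qed.

Lemma coord_le_norm m (M : 'M[R]_(m, n)) i j : `|M i j| <= `|M|.
Proof.
rewrite [leRHS]/Num.Def.normr/= mx_normrE.
exact: (@le_bigmax _ _ _ 0 (fun k : 'I_m * 'I_n => `|M k.1 k.2|) (i, j)).
Qed.

Lemma norm_le_coord m (M : 'M[R]_(m, n)) e :
  0 <= e -> (forall i j, `|M i j| <= e) -> `|M| <= e.
Proof.
move=> e0 h; rewrite [leLHS]/Num.Def.normr/= mx_normrE.
by apply: bigmax_le => // -[i j] _; exact: h.
Qed.

Lemma norm_le_enorm x : `|x| <= enorm x.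
Proof.
apply: norm_le_coord; first exact: enorm_ge0.
move=> i j; rewrite ord1 -sqrtr_sqr ler_sqrt ?dotvv_ge0// expr2.
rewrite /dotv (bigD1 j)//= lerDl; apply: sumr_ge0 => k _.
by rewrite -expr2 sqr_ge0.
Qed.

Lemma dotv_le_norm x y : `|dotv x y| <= n%:R * `|x| * `|y|.
Proof.
apply: le_trans (ler_norm_sum _ _ _) _.
apply: (@le_trans _ _ (\sum_(i < n) `|x| * `|y|)).
  by apply: ler_sum => i _; rewrite normrM ler_pM// coord_le_norm.
by rewrite sumr_const card_ord -mulrA mulr_natl.
Qed.

Lemma enorm_le_norm x : enorm x <= n.+1%:R * `|x|.
Proof.
have h : dotv x x <= (n.+1%:R * `|x|) ^+ 2.
  apply: le_trans (ler_norm _) _; apply: le_trans (dotv_le_norm _ _) _.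
  rewrite exprMn -mulrA -[`|x| * `|x|]expr2 ler_wpM2r ?sqr_ge0//.
  by rewrite expr2 -natrM ler_nat mulSn leqW// leq_addr.
by rewrite -(@ger0_norm _ (n.+1%:R * _)) ?mulr_ge0// -sqrtr_sqr ler_sqrt ?sqr_ge0.
Qed.

End Dot.

Section Limits.
Context {T : Type} {F : set_system T} {FF : Filter F}.

Lemma cvg_sum (I : Type) (r : seq I) (P : pred I) (f : I -> T -> R) (a : I -> R) :
  (forall i, P i -> f i t @[t --> F] --> a i) ->
  \sum_(i <- r | P i) f i t @[t --> F] --> \sum_(i <- r | P i) a i.
Proof. by move=> h; apply: cvg_big h; exact: add_continuous. Qed.

Lemma cvg_prod (I : Type) (r : seq I) (P : pred I) (f : I -> T -> R) (a : I -> R) :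
  (forall i, P i -> f i t @[t --> F] --> a i) ->
  \prod_(i <- r | P i) f i t @[t --> F] --> \prod_(i <- r | P i) a i.
Proof. by move=> h; apply: cvg_big h; exact: mul_continuous. Qed.

Lemma cvg_coord m n (f : T -> 'M[R]_(m, n)) (M : 'M[R]_(m, n)) i j :
  f t @[t --> F] --> M -> f t i j @[t --> F] --> M i j.
Proof.
by move=> h; have := continuous_cvg FF (@coord_continuous _ _ _ i j M) h; exact.
Qed.

Lemma cvg_mx m n (f : T -> 'M[R]_(m, n)) (M : 'M[R]_(m, n)) :
  (forall i j, f t i j @[t --> F] --> M i j) -> f t @[t --> F] --> M.
Proof.
move=> h; apply/cvgrPdist_le => e e0; near=> t.
apply: norm_le_coord; first exact: ltW.
move=> i j; rewrite !mxE; move: i j; near: t.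
apply: filter_forall => i; apply: filter_forall => j.
by have /cvgrPdist_le/(_ _ e0) := h i j.
Unshelve. all: by end_near. Qed.

Lemma cvg_dotv n (f g : T -> 'rV[R]_n) (a b : 'rV[R]_n) :
  f t @[t --> F] --> a -> g t @[t --> F] --> b ->
  dotv (f t) (g t) @[t --> F] --> dotv a b.
Proof.
by move=> fa gb; apply: cvg_sum => i _; apply: cvgM; exact: cvg_coord.
Qed.

Lemma cvg_det n (f : T -> 'M[R]_n) (M : 'M[R]_n) :
  f t @[t --> F] --> M -> \det (f t) @[t --> F] --> \det M.
Proof.
move=> fM; apply: cvg_sum => s _; apply: cvgM; first exact: cvg_cst.
by apply: cvg_prod => i _; exact: cvg_coord.
Qed.

(** Invertibility is nonvanishing of the determinant, an open condition. *)
Lemma cvg_unitmx n (f : T -> 'M[R]_n) (M : 'M[R]_n) : M \in unitmx ->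
  f t @[t --> F] --> M -> \forall t \near F, f t \in unitmx.
Proof.
rewrite unitmxE unitfE => M0 /cvg_det /cvgr_neq0 h.
by apply: filterS (h M0) => t; rewrite unitmxE unitfE.
Qed.

(** Cramer's rule: the inverse is continuous because determinant and adjugate are
polynomials in the entries. *)
Lemma cvg_invmx n (f : T -> 'M[R]_n) (M : 'M[R]_n) : M \in unitmx ->
  f t @[t --> F] --> M -> invmx (f t) @[t --> F] --> invmx M.
Proof.
move=> M0 fM; have f0 := cvg_unitmx M0 fM.
have dM : (\det (f t))^-1 @[t --> F] --> (\det M)^-1.
  by apply: cvgV; [move: M0; rewrite unitmxE unitfE|exact: cvg_det].
have aM i j : \adj (f t) i j @[t --> F] --> \adj M i j.
  rewrite mxE; under eq_fun do rewrite mxE.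
  apply: cvgM; first exact: cvg_cst.
  apply: cvg_det; apply: cvg_mx => k l; rewrite !mxE.
  by under eq_fun do rewrite !mxE; exact: cvg_coord.
rewrite {2}/invmx M0; have : (\det (f t))^-1 *: \adj (f t) @[t --> F] -->
    (\det M)^-1 *: \adj M.
  apply: cvg_mx => i j; rewrite mxE; under eq_fun do rewrite mxE.
  exact: cvgM.
apply: cvg_trans; apply: near_eq_cvg.
by apply: filterS f0 => t ft; rewrite /invmx ft.
Qed.

End Limits.

Lemma eball_nbhs n (y : 'rV[R]_n) r : 0 < r -> \forall x \near y, eball y r x.
Proof.
move=> r0; have r1 : 0 < r / n.+1%:R by rewrite divr_gt0.
apply: filterS (nbhsx_ballx y _ r1) => x; rewrite -ball_normE/= => yx.
apply: le_lt_trans (enorm_le_norm _) _.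
by rewrite mulrC -ltr_pdivlMr// distrC.
Qed.

Lemma nbhs_eball n (y : 'rV[R]_n) (P : 'rV[R]_n -> Prop) :
  (\forall x \near y, P x) -> exists2 r, 0 < r & forall x, eball y r x -> P x.
Proof.
move=> /nbhs_ballP[e /= e0 h]; exists e => // x yx; apply: h.
rewrite -ball_normE/= distrC; exact: le_lt_trans (norm_le_enorm _) yx.
Qed.

End Vectors.

(** * Strict differentiability *)

Section StrictDiff.
Context {R : realType}.

Section Diagonal.
Context {T : topologicalType}.
Implicit Types y : T.

Lemma near_fst (P : T -> Prop) y :
  (\forall x \near y, P x) -> \forall p \near (y, y), P p.1.
Proof. by move=> h; exact: (@cvg_fst _ _ (nbhs y) (nbhs y) _ P h). Qed.

Lemma near_snd (P : T -> Prop) y :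
  (\forall x \near y, P x) -> \forall p \near (y, y), P p.2.
Proof. by move=> h; exact: (@cvg_snd _ _ (nbhs y) (nbhs y) _ P h). Qed.

Lemma near2W (P : T * T -> Prop) y :
  (forall p, P p) -> \forall p \near (y, y), P p.
Proof. exact: (@nearW _ (nbhs (y, y))). Qed.

Lemma near1W (P : T -> Prop) y : (forall x, P x) -> \forall x \near y, P x.
Proof. exact: (@nearW _ (nbhs y)). Qed.

Lemma near_right (P : T * T -> Prop) y :
  (\forall p \near (y, y), P p) -> \forall x \near y, P (y, x).
Proof.
by move=> h; exact: (@cvg_pair _ _ _ (nbhs y) (nbhs y) (nbhs y) _ _ _ (cst y) id
  (@cvg_cst _ y _ _ _) cvg_id P h).
Qed.

Lemma near_diag (P : T * T -> Prop) y :
  (\forall p \near (y, y), P p) -> \forall x \near y, \forall p \near (x, x), P p.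
Proof.
move=> /(@near_join (T * T)%type) h.
exact: (@cvg_pair _ _ _ (nbhs y) (nbhs y) (nbhs y) _ _ _ id id
  cvg_id cvg_id _ h).
Qed.

Lemma cvg_left (U : Type) (G : set_system U) (f : T -> U) y :
  f x @[x --> y] --> G -> f p.1 @[p --> (y, y)] --> G.
Proof. by apply: cvg_comp; exact: (@cvg_fst _ _ (nbhs y) (nbhs y) _). Qed.

Lemma cvg_right (U : Type) (G : set_system U) (f : T -> U) y :
  f x @[x --> y] --> G -> f p.2 @[p --> (y, y)] --> G.
Proof. by apply: cvg_comp; exact: (@cvg_snd _ _ (nbhs y) (nbhs y) _). Qed.

Lemma cvg_both (U : topologicalType) (f : T -> U) (l : U) y :
  f x @[x --> y] --> l -> (f p.1, f p.2) @[p --> (y, y)] --> (l, l).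
Proof. by move=> fl; exact: cvg_pair (cvg_left fl) (cvg_right fl). Qed.

End Diagonal.
Section StrictGradient.
Context {n : nat}.
Local Notation V := 'rV[R]_n.
Implicit Types (x y v : V) (f g : V -> R).

Lemma dotv_sumr (I : Type) (r : seq I) (P : pred I) (a : I -> V) x :
  dotv x (\sum_(i <- r | P i) a i) = \sum_(i <- r | P i) dotv x (a i).
Proof.
by elim/big_rec2 : _ => [|i a1 a2 _ <-]; rewrite ?dotv0 ?dotvDr.
Qed.

Lemma near_dist y e : 0 < e -> \forall x \near y, `|y - x| <= e.
Proof.
move=> e0; apply: filterS (nbhsx_ballx y _ e0) => x.
by rewrite -ball_normE/= => /ltW.
Qed.

(** Differentiability on a neighbourhood with continuous gradient amounts to this
property at all points of the neighbourhood; unlike differentiability at a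
point, it compares two moving points. *)
Definition sdiff f y v := exists2 W : V * V -> V,
  W p @[p --> (y, y)] --> v &
  \forall p \near (y, y), f p.1 - f p.2 = dotv (p.1 - p.2) (W p).

Definition lip (f : V -> R) y := exists2 L, 0 < L &
  \forall p \near (y, y), `|f p.1 - f p.2| <= L * `|p.1 - p.2|.

Lemma sdiff_lip f y v : sdiff f y v -> lip f y.
Proof.
move=> [W Wv fW]; exists (n%:R * (`|v| + 1) + 1).
  by rewrite ltr_wpDl// mulr_ge0// addr_ge0.
have W1 : \forall p \near (y, y), `|W p| <= `|v| + 1.
  by apply: (cvgr_norm_le _ Wv); rewrite ltrDl.
apply: filterS2 W1 fW => p W1 ->; apply: le_trans (dotv_le_norm _ _) _.
have := ler_wpM2l (mulr_ge0 (ler0n R n) (normr_ge0 (p.1 - p.2))) W1.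
by move=> /le_trans; apply; rewrite mulrDl mul1r mulrAC lerDl.
Qed.

Lemma lip_near f y : lip f y -> \forall x \near y, lip f x.
Proof.
by move=> [L L0 /near_diag]; apply: filterS => x fx; exists L.
Qed.

Lemma lip_cvg f y : lip f y -> f x @[x --> y] --> f y.
Proof.
move=> [L L0 /near_right fy]; apply/(@cvgrPdist_le _ _ _ (nbhs y)) => e e0; near=> x.
apply: (@le_trans _ _ (L * `|y - x|)); first by near: x.
rewrite -ler_pdivlMl//; near: x.
by apply: near_dist; rewrite mulr_gt0// invr_gt0.
Unshelve. all: by end_near. Qed.

Lemma sdiff_cvg f y v : sdiff f y v -> f x @[x --> y] --> f y.
Proof. by move/sdiff_lip/lip_cvg. Qed.

Lemma sdiff_ext f g y v : (\forall x \near y, f x = g x) ->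
  sdiff f y v -> sdiff g y v.
Proof.
move=> fg [W Wv fW]; exists W => //.
by apply: filterS3 (near_fst fg) (near_snd fg) fW => p <- <-.
Qed.

Lemma sdiff_cst c y : sdiff (fun=> c) y 0.
Proof.
by exists (cst 0); [exact: cvg_cst|apply: near2W => p; rewrite subrr dotv0].
Qed.

Lemma sdiff_dot a y : sdiff (fun x => dotv x a) y a.
Proof.
by exists (cst a); [exact: cvg_cst|apply: near2W => p; rewrite dotvBl].
Qed.

Lemma sdiffD f g y u v : sdiff f y u -> sdiff g y v ->
  sdiff (fun x => f x + g x) y (u + v).
Proof.
move=> [W Wu fW] [Z Zv gZ]; exists (fun p => W p + Z p); first exact: cvgD.
by apply: filterS2 fW gZ => p fp gp; rewrite dotvDr -fp -gp; ring.
Qed.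

(** The increment of the product is f(p1) (g(p1) - g(p2)) + g(p2) (f(p1) - f(p2)). *)
Lemma sdiffM f g y u v : sdiff f y u -> sdiff g y v ->
  sdiff (fun x => f x * g x) y (f y *: v + g y *: u).
Proof.
move=> fu gv; have cf := cvg_left (sdiff_cvg fu).
have cg := cvg_right (sdiff_cvg gv); case: fu gv => [W Wu fW] [Z Zv gZ].
exists (fun p => f p.1 *: Z p + g p.2 *: W p).
  by apply: cvgD; apply: cvgZ.
by apply: filterS2 fW gZ => p fp gp; rewrite dotvDr !dotvZr -fp -gp; ring.
Qed.

Lemma sdiffZ c f y u : sdiff f y u -> sdiff (fun x => c * f x) y (c *: u).
Proof.
by move=> fu; have := sdiffM (sdiff_cst c y) fu; rewrite scaler0 addr0.
Qed.

Lemma sdiff_sum (I : Type) (r : seq I) (P : pred I) (f : I -> V -> R) (v : I -> V) y :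
  (forall i, P i -> sdiff (f i) y (v i)) ->
  sdiff (fun x => \sum_(i <- r | P i) f i x) y (\sum_(i <- r | P i) v i).
Proof.
move=> h; elim: r => [|i r ih].
  rewrite big_nil; apply: sdiff_ext (sdiff_cst 0 y).
  by apply: near1W => x; rewrite big_nil.
rewrite big_cons; have [Pi|Pi] := boolP (P i); last first.
  by apply: sdiff_ext ih; apply: near1W => x; rewrite big_cons (negbTE Pi).
apply: sdiff_ext (sdiffD (h _ Pi) ih).
by apply: near1W => x; rewrite big_cons Pi.
Qed.

Lemma sdiffV f y u : f y != 0 -> sdiff f y u ->
  sdiff (fun x => (f x)^-1) y (- (f y) ^- 2 *: u).
Proof.
move=> fy0 fu; have cf := sdiff_cvg fu.
have nf : \forall x \near y, f x != 0 by exact: cvgr_neq0 _ cf fy0.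
have c1 := cvg_left cf; have c2 := cvg_right cf.
case: fu => [W Wu fW]; exists (fun p => - (f p.1 * f p.2)^-1 *: W p).
  apply: cvgZ => //; apply: cvgN; rewrite expr2; apply: cvgV.
    by rewrite mulf_neq0.
  exact: cvgM.
apply: filterS3 (near_fst nf) (near_snd nf) fW => p f1 f2 fp.
by rewrite dotvZr -fp; field; rewrite f1 f2.
Qed.

(** The slope comes from sqrt a - sqrt b = (a - b) / (sqrt a + sqrt b). *)
Lemma sdiff_sqrt f y u : 0 < f y -> sdiff f y u ->
  sdiff (fun x => Num.sqrt (f x)) y ((2 * Num.sqrt (f y))^-1 *: u).
Proof.
move=> fy0 fu; have cf := sdiff_cvg fu.
have nf : \forall x \near y, 0 < f x by exact: cvgr_gt _ cf _ fy0.
have cs : Num.sqrt (f x) @[x --> y] --> Num.sqrt (f y).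
  exact: continuous_cvg (@sqrt_continuous _ _) cf.
have c1 := cvg_left cs; have c2 := cvg_right cs.
case: fu => [W Wu fW].
exists (fun p => (Num.sqrt (f p.1) + Num.sqrt (f p.2))^-1 *: W p).
  apply: cvgZ => //; apply: cvgV.
    by rewrite mulf_neq0// gt_eqF// sqrtr_gt0.
  by rewrite mulrDl mul1r; exact: cvgD.
apply: filterS3 (near_fst nf) (near_snd nf) fW => p f1 f2 fp.
rewrite dotvZr -fp -[in f p.1 - _](sqr_sqrtr (ltW f1)) -[in _ - f p.2](sqr_sqrtr (ltW f2)).
rewrite subr_sqr mulrC mulfK// gt_eqF// addr_gt0// sqrtr_gt0//.
Qed.

End StrictGradient.
End StrictDiff.

Section StrictCalculus.
Context {R : realType} {n : nat}.
Local Notation V := 'rV[R]_n.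
Implicit Types (x y v h : V) (f g : V -> R).

Lemma cvg_vec m (phi : V -> 'rV[R]_m) y :
  (forall i, lip (fun x => phi x 0 i) y) -> phi x @[x --> y] --> phi y.
Proof.
move=> h; apply: (@cvg_mx _ _ (nbhs y) _) => i j.
by rewrite ord1; exact: lip_cvg.
Qed.

Lemma sdiff_comp m (f : 'rV[R]_m -> R) (phi : V -> 'rV[R]_m) (D : 'I_m -> V) y w :
  sdiff f (phi y) w -> (forall i, sdiff (fun x => phi x 0 i) y (D i)) ->
  sdiff (fun x => f (phi x)) y (\sum_i w 0 i *: D i).
Proof.
move=> [W Ww fW] phiD; have phiy : phi x @[x --> y] --> phi y.
  by apply: cvg_vec => i; exact: sdiff_lip (phiD i).
have phi2 := cvg_both phiy.
have [Z Zy phiZ] : exists2 Z : 'I_m -> V * V -> V,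
    forall i, Z i p @[p --> (y, y)] --> D i &
    \forall p \near (y, y), forall i,
      phi p.1 0 i - phi p.2 0 i = dotv (p.1 - p.2) (Z i p).
  have /choice[Z hZ] : forall i, exists Z : V * V -> V,
      Z p @[p --> (y, y)] --> D i /\
      \forall p \near (y, y), phi p.1 0 i - phi p.2 0 i = dotv (p.1 - p.2) (Z p).
    by move=> i; have [Z h1 h2] := phiD i; exists Z.
  exists Z => [i|]; first exact: (hZ i).1.
  exact: (@filter_forall _ _ _ (nbhs (y, y)) _ (fun i => (hZ i).2)).
exists (fun p => \sum_i W (phi p.1, phi p.2) 0 i *: Z i p).
  apply: cvg_big => [|i _]; first exact: add_continuous.
  apply: cvgZ; last exact: Zy.
  by apply: cvg_coord; exact: cvg_comp phi2 Ww.
have fphi : \forall p \near (y, y), f (phi p.1) - f (phi p.2) =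
    dotv (phi p.1 - phi p.2) (W (phi p.1, phi p.2)) by exact: (phi2 _ fW).
apply: filterS2 fphi phiZ => p -> phip.
rewrite dotv_sumr; apply: eq_bigr => i _.
by rewrite !mxE phip dotvZr mulrC.
Qed.

Lemma sdiff_derive f y v h : sdiff f y v -> is_derive y h f (dotv h v).
Proof.
move=> [W Wv fW].
have c0 : t *: h + y @[t --> (0:R)^'] --> y.
  rewrite -[X in _ --> X](_ : 0 *: h + y = y); last by rewrite scale0r add0r.
  apply: cvgD; last exact: cvg_cst.
  apply: cvgZ; last exact: cvg_cst.
  exact: (@nbhs_dnbhs R 0).
have c1 : (t *: h + y, y) @[t --> (0:R)^'] --> (y, y).
  exact: cvg_pair c0 (cvg_cst y).
have hl : t^-1 *: (f (t *: h + y) - f y) @[t --> (0:R)^'] --> dotv h v.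
  have c2 : dotv h (W (t *: h + y, y)) @[t --> (0:R)^'] --> dotv h v.
    by apply: cvg_dotv; [exact: cvg_cst|exact: cvg_comp c1 Wv].
  apply: cvg_trans c2; apply: near_eq_cvg.
  have h1 : \forall t \near (0:R)^', f (t *: h + y) - f y =
    dotv (t *: h + y - y) (W (t *: h + y, y)) by exact: (c1 _ fW).
  have h2 : \forall t \near (0:R)^', t != 0 by exact: nbhs_dnbhs_neq.
  apply: filterS2 h1 h2 => t -> t0.
  by rewrite addrK dotvZl -[RHS]/(t^-1 * _) mulKf.
split; first by apply/cvg_ex; exists (dotv h v).
exact: cvg_lim hl.
Qed.

Lemma sdiff_pderiv f y v i : sdiff f y v -> pderiv i f y = v 0 i.
Proof.
move=> fv; rewrite -dotv_delta.
by case: (sdiff_derive (delta_mx 0 i) fv).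
Qed.

Lemma sdiff_uniq f y u v : sdiff f y u -> sdiff f y v -> u = v.
Proof.
by move=> fu fv; apply/rowP => i; rewrite -(sdiff_pderiv i fu) (sdiff_pderiv i fv).
Qed.

Lemma line_derive f x h (u d : R) :
  is_derive (x + u *: h) h f d -> is_derive u (1 : R) (fun t => f (x + t *: h)) d.
Proof.
have E : (fun t : R => t^-1 *: (f (t *: h + (x + u *: h)) - f (x + u *: h))) =
   (fun t : R => t^-1 *: (f (x + (t *: (1 : R) + u) *: h) - f (x + u *: h))).
  apply/funext => t; congr (_ *: (f _ - _)).
  by rewrite -[t *: (1:R)]/(t * 1) mulr1 scalerDl addrCA addrC -addrA [u *: h + _]addrC.
move=> [dfx dfv]; split.
  by move: dfx; rewrite /derivable /= E.
by move: dfv; rewrite /derive /= E.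
Qed.

(** The step length c is a separate factor, possibly negative or zero, so that
the statement applies to moves along one coordinate axis. *)
Lemma mvt_dir f x h c (D : V -> R) :
  (forall s : R, 0 <= s <= 1 -> is_derive (x + (s * c) *: h) h f (D (x + (s * c) *: h))) ->
  exists2 s : R, 0 <= s <= 1 & f (x + c *: h) - f x = c * D (x + (s * c) *: h).
Proof.
move=> fD; pose g (s : R) := f (x + (s * c) *: h).
have dg (s : R) : 0 <= s <= 1 -> is_derive s (1 : R) g (c * D (x + (s * c) *: h)).
  move=> /fD /line_derive d1; rewrite [c * D _]mulrC.
  have d2 : is_derive s (1 : R) (fun t : R => t * c) c.
    have := @is_deriveM R R^o id (cst c) s 1 1 0 _ _.
    rewrite /cst/= => h1; apply: is_derive_eq (h1 _ _) _.
    by rewrite scaler0 add0r -[LHS]/(c * 1) mulr1.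
  exact: (@is_derive1_comp R (fun t => f (x + t *: h)) ( *%R^~ c) s _ _ d1 d2).
have gc : {within `[0, 1], continuous g}.
  have : {in `[0, 1]%classic, continuous g}.
    move=> t; rewrite inE/= in_itv/= => /dg dt.
    by apply: differentiable_continuous; apply/derivable1_diffP; case: dt.
  exact: continuous_in_subspaceT.
have [s|s] := @MVT_segment R g (fun s => c * D (x + (s * c) *: h)) 0 1 ler01 _ gc.
  by rewrite in_itv/= => /andP[s0 s1]; apply: dg; rewrite !ltW.
rewrite in_itv/= subr0 mulr1 => s01; rewrite /g mul0r scale0r addr0 mul1r => gE.
by exists s.
Qed.

End StrictCalculus.

(** * Mean values and continuous partial derivatives *)

Section MeanValue.
Context {R : realType} {n : nat}.
Local Notation V := 'rV[R]_n.
Implicit Types (x y v h : V) (f g : V -> R).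

Lemma nbhs_dist y (P : V -> Prop) : (\forall x \near y, P x) ->
  exists2 e, 0 < e & forall x, `|x - y| < e -> P x.
Proof.
move=> /nbhs_ballP[e /= e0 h]; exists e => // x yx; apply: h.
by rewrite -ball_normE/= distrC.
Qed.

Lemma near2_dist y e : 0 < e ->
  \forall p \near (y, y), `|p.1 - y| + `|p.2 - y| < e.
Proof.
move=> e0; have e2 : 0 < e / 2 by rewrite divr_gt0.
have h : \forall x \near y, `|x - y| < e / 2.
  apply: filterS (nbhsx_ballx y _ e2) => x.
  by rewrite -ball_normE/= distrC.
by apply: filterS2 (near_fst h) (near_snd h) => p h1 h2; lra.
Qed.

Lemma segment_dist y a b (s : R) : 0 <= s <= 1 ->
  `|b + s *: (a - b) - y| <= `|a - y| + `|b - y|.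
Proof.
move=> /andP[s0 s1].
have -> : b + s *: (a - b) - y = s *: (a - y) + (1 - s) *: (b - y).
  by apply/rowP => i; rewrite !mxE; ring.
apply: le_trans (ler_normD _ _) _; rewrite !normrZ ger0_norm// ger0_norm ?subr_ge0//.
by have := normr_ge0 (a - y); have := normr_ge0 (b - y); nra.
Qed.

(** P carries what is known about the gradient near y, for instance that it has
norm one. *)
Lemma sdiff_mvt f (Df : V -> V) (P : V -> Prop) y :
  (\forall x \near y, sdiff f x (Df x)) -> (\forall x \near y, P x) ->
  \forall p \near (y, y), exists2 z, P z &
    f p.1 - f p.2 = dotv (p.1 - p.2) (Df z).
Proof.
move=> fD yP; have [e e0 he] := nbhs_dist (filterI fD yP).
apply: filterS (near2_dist y e0) => p pe.
have seg (s : R) : 0 <= s <= 1 ->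
    `|p.2 + (s * 1) *: (p.1 - p.2) - y| < e.
  by move=> s01; rewrite mulr1; apply: le_lt_trans (segment_dist _ _ _ s01) _.
have [s s01|s s01] := @mvt_dir R n f p.2 (p.1 - p.2) 1
  (fun z => dotv (p.1 - p.2) (Df z)).
  by apply: sdiff_derive; have [] := he _ (seg s s01).
rewrite scale1r [p.2 + _]addrC subrK mul1r => E.
by exists (p.2 + (s * 1) *: (p.1 - p.2)) => //; have [] := he _ (seg s s01).
Qed.

Let mixed (a b : V) (k : nat) : V := \row_i (if (i < k)%N then b 0 i else a 0 i).

Lemma mixed_step a b (k : 'I_n) :
  mixed a b k = mixed a b k.+1 + (a 0 k - b 0 k) *: delta_mx 0 k.
Proof.
apply/rowP => i; rewrite !mxE eqxx/= ltnS [(i <= k)%N]leq_eqVlt.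
have [->|ik] := eqVneq i k.
  by rewrite ltnn eqxx/= mulr1 addrC subrK.
by rewrite (_ : (nat_of_ord i == k) = false) ?mulr0 ?addr0//; exact/negbTE.
Qed.

(** Between two points the coordinates are changed one at a time; each step has
a mean value of one partial derivative as its slope, and these tend to the
partial derivatives at y by continuity. *)
Lemma sdiff_partials f (D : 'I_n -> V -> R) y :
  (\forall x \near y, forall i, is_derive x (delta_mx 0 i) f (D i x)) ->
  (forall i, D i x @[x --> y] --> D i y) ->
  sdiff f y (\row_i D i y).
Proof.
move=> fD0 Dy; have [e e0 fD] := nbhs_dist fD0.
have /choice[Z hZ] : forall q : (V * V) * 'I_n, exists z : V,
    `|z - y| <= `|q.1.1 - y| + `|q.1.2 - y| /\
    (`|q.1.1 - y| + `|q.1.2 - y| < e ->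
     f (mixed q.1.1 q.1.2 q.2) - f (mixed q.1.1 q.1.2 q.2.+1) =
     (q.1.1 0 q.2 - q.1.2 0 q.2) * D q.2 z).
  move=> [[a b] k] /=.
  have [pe|pe] := ltP (`|a - y| + `|b - y|) e; last first.
    by exists y; split => //; rewrite subrr normr0 addr_ge0.
  have seg (s : R) : 0 <= s <= 1 ->
      `|mixed a b k.+1 + (s * (a 0 k - b 0 k)) *: delta_mx 0 k - y|
        <= `|a - y| + `|b - y|.
    move=> /andP[s0 s1]; apply: norm_le_coord; first by rewrite addr_ge0.
    move=> i' i; rewrite ord1 !mxE eqxx/=.
    have ha := coord_le_norm (a - y) 0 i; have hb := coord_le_norm (b - y) 0 i.
    rewrite !mxE in ha hb.
    have [ik|ik] := eqVneq i k.
      rewrite ik in ha hb *; rewrite ltnSn mulr1 (_ : _ - y 0 k =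
        s * (a 0 k - y 0 k) + (1 - s) * (b 0 k - y 0 k)); last by ring.
      apply: le_trans (ler_normD _ _) _.
      rewrite !normrM ger0_norm// [X in _ + X * _]ger0_norm ?subr_ge0//.
      by have := normr_ge0 (a 0 k - y 0 k); have := normr_ge0 (b 0 k - y 0 k); nra.
    rewrite mulr0 addr0; case: ifP => _.
      by apply: le_trans hb _; rewrite lerDr.
    by apply: le_trans ha _; rewrite lerDl.
  have [s s01|s s01 E] := @mvt_dir R n f (mixed a b k.+1) (delta_mx 0 k)
    (a 0 k - b 0 k) (D k).
    by apply: fD; apply: le_lt_trans (seg s s01) pe.
  by exists (mixed a b k.+1 + (s * (a 0 k - b 0 k)) *: delta_mx 0 k);
    split => [|_]; [exact: seg|rewrite -E -mixed_step].
exists (fun p => \row_i D i (Z (p, i))).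
  apply: (@cvg_mx _ _ (nbhs (y, y)) _) => i j; rewrite !mxE.
  under eq_fun do rewrite mxE.
  apply: cvg_comp (Dy j); apply/cvgrPdist_le => d d0; near=> p.
  rewrite distrC; apply: le_trans (hZ (p, j)).1 _; apply: ltW.
  by near: p; exact: near2_dist.
apply: filterS (near2_dist y e0) => -[a b] /= abe.
have -> : f a - f b = f (mixed a b 0) - f (mixed a b n).
  by congr (f _ - f _); apply/rowP => i; rewrite !mxE ?ltn0 ?ltn_ord.
rewrite -opprB -(telescope_sumr (fun k => f (mixed a b k)) (leq0n n)).
rewrite big_mkord -sumrN.
apply: eq_bigr => k _; rewrite opprB !mxE.
by have [_ ->] := hZ ((a, b), k).
Unshelve. all: by end_near. Qed.

End MeanValue.

(** * Germs of class C^(k,alpha) *)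

Section Germs.
Context {R : realType}.
Variable alpha : R.
Hypothesis alpha01 : 0 <= alpha <= 1.

Lemma le_powR_unit (t : R) : 0 <= t <= 1 -> t <= t `^ alpha.
Proof.
move: alpha01 => /andP[a0 a1] /andP[t0 t1].
have [->|tn0] := eqVneq t 0; first exact: powR_ge0.
by rewrite -[leLHS]powRr1// ger_powR// t1 lt_def tn0 t0.
Qed.

Lemma ge0_le_powR (s t : R) : 0 <= s -> s <= t -> s `^ alpha <= t `^ alpha.
Proof.
move: alpha01 => /andP[a0 a1] s0 st; apply: ge0_ler_powR => //; rewrite nnegrE//.
exact: le_trans st.
Qed.

Section Class.
Context {n : nat}.
Local Notation V := 'rV[R]_n.
Implicit Types (x y v : V) (f g : V -> R).

(** For alpha = 0 the power is 1, including at p.1 = p.2, so that only boundedness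
of the oscillation remains. *)
Definition near_holder f y := exists2 C, 0 <= C &
  \forall p \near (y, y), `|f p.1 - f p.2| <= C * `|p.1 - p.2| `^ alpha.

(** Local version of a Hoelder class.  Neighbourhoods are left to the filters, so
that products, quotients and compositions need no shrinking of balls, and the
gradient is a given map rather than the function of partial derivatives, which
is only determined near y. *)
Fixpoint germ (k : nat) y f : Prop :=
  match k with
  | 0%N => (\forall x \near y, f z @[z --> x] --> f x) /\ near_holder f y
  | k'.+1 => exists2 Df : V -> V, \forall x \near y, sdiff f x (Df x) &
      forall i, germ k' y (fun x => Df x 0 i)
  end.

(** At distance at most one, t <= t^alpha because alpha <= 1. *)
Lemma lip_germ0 f y : lip f y -> germ 0 y f.
Proof.
move=> fl; split.
  by apply: filterS (lip_near fl) => x; exact: lip_cvg.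
case: fl => L L0 fL; exists L; first exact: ltW.
have p1 : \forall p \near (y, y), `|p.1 - p.2| <= 1.
  apply: filterS (near2_dist y ltr01) => p h.
  rewrite (_ : p.1 - p.2 = (p.1 - y) - (p.2 - y)); last by rewrite opprB subrKA.
  exact: le_trans (ler_normB _ _) (ltW h).
apply: filterS2 p1 fL => p h /le_trans; apply.
by rewrite ler_pM2l// le_powR_unit// h normr_ge0.
Qed.

Lemma germ_lip k f y : germ k.+1 y f -> lip f y.
Proof. by move=> [Df /nbhs_singleton/sdiff_lip]. Qed.

Lemma germ_pred k f y : germ k.+1 y f -> germ k y f.
Proof.
elim: k f => [f /germ_lip/lip_germ0//|k ih f [Df fD DfG]].
by exists Df => // i; exact/ih/DfG.
Qed.

Lemma germ_le j k f y : (j <= k)%N -> germ k y f -> germ j y f.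
Proof.
move=> /subnK <-; elim: (k - j)%N => // l ih.
by rewrite addSn => /germ_pred.
Qed.

Lemma germ_cvg k f y : germ k y f -> f x @[x --> y] --> f y.
Proof. by move=> /(germ_le (leq0n k)) [/nbhs_singleton]. Qed.

Lemma germ_near k f y : germ k y f -> \forall x \near y, germ k x f.
Proof.
elim: k f => [f [fc [C C0 fC]]|k ih f [Df fD DfG]].
  apply: filterS2 (near_join fc) (near_diag fC) => x h1 h2.
  by split=> //; exists C.
have h : \forall x \near y, forall i, germ k x (fun x => Df x 0 i).
  exact: (@filter_forall _ _ _ (nbhs y) _ (fun i => ih _ (DfG i))).
by apply: filterS2 (near_join fD) h => x h1 h2; exists Df.
Qed.

Lemma germ_ext k f g y : (\forall x \near y, f x = g x) ->
  germ k y f -> germ k y g.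
Proof.
move=> fg; case: k => [[fc [C C0 fC]]|k [Df fD DfG]].
  split; last first.
    exists C => //; apply: filterS3 (near_fst fg) (near_snd fg) fC => p.
    by move=> <- <-.
  apply: filterS2 (near_join fg) fc => x h hx.
  by rewrite -(nbhs_singleton h); exact: cvg_trans (near_eq_cvg h) hx.
exists Df => //; apply: filterS2 (near_join fg) fD => x.
exact: sdiff_ext.
Qed.

Lemma germ_cst k c y : germ k y (fun=> c).
Proof.
elim: k c => [|k ih] c.
  by apply/lip_germ0/sdiff_lip; exact: sdiff_cst.
exists (cst 0); first by apply: near1W => x; exact: sdiff_cst.
by move=> i; exact: ih.
Qed.

Lemma germ_dot k a y : germ k y (fun x => dotv x a).
Proof.
case: k => [|k].
  by apply/lip_germ0/sdiff_lip; exact: sdiff_dot.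
exists (cst a); first by apply: near1W => x; exact: sdiff_dot.
by move=> i; exact: germ_cst.
Qed.

Lemma germ_coord k i y : germ k y (fun x => x 0 i).
Proof.
apply: germ_ext (germ_dot k (delta_mx 0 i) y).
by apply: near1W => x; rewrite dotvC dotv_delta.
Qed.

Lemma germD k f g y : germ k y f -> germ k y g -> germ k y (fun x => f x + g x).
Proof.
elim: k f g => [f g [fc [C C0 fC]] [gc [E E0 gE]]|k ih f g [Df fD fG] [Dg gD gG]].
  split; first by apply: filterS2 fc gc => x h1 h2; have := cvgD h1 h2; exact.
  exists (C + E); first exact: addr_ge0.
  apply: filterS2 fC gE => p fp gp; rewrite mulrDl opprD addrACA.
  by apply: le_trans (ler_normD _ _) _; exact: lerD.
exists (fun x => Df x + Dg x); first by apply: filterS2 fD gD => x; exact: sdiffD.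
move=> i; apply: germ_ext (ih _ _ (fG i) (gG i)).
by apply: near1W => x; rewrite mxE.
Qed.

Lemma germM k f g y : germ k y f -> germ k y g -> germ k y (fun x => f x * g x).
Proof.
elim: k f g => [f g hf hg|k ih f g hf hg].
  have := cvg_left (germ_cvg hf) => cf; have cg := cvg_right (germ_cvg hg).
  case: hf hg => [fc [C C0 fC]] [gc [E E0 gE]].
  split; first by apply: filterS2 fc gc => x h1 h2; have := cvgM h1 h2; exact.
  have f1 : \forall p \near (y, y), `|f p.1| <= `|f y| + 1.
    by apply: (cvgr_norm_le _ cf); rewrite ltrDl.
  have g1 : \forall p \near (y, y), `|g p.2| <= `|g y| + 1.
    by apply: (cvgr_norm_le _ cg); rewrite ltrDl.
  exists ((`|f y| + 1) * E + (`|g y| + 1) * C).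
    by rewrite addr_ge0// mulr_ge0// addr_ge0.
  apply: filterS2 (filterI f1 g1) (filterI fC gE) => p [f1p g1p] [fp gp].
  rewrite (_ : _ - _ = f p.1 * (g p.1 - g p.2) + g p.2 * (f p.1 - f p.2)); last by ring.
  apply: le_trans (ler_normD _ _) _; rewrite !normrM [leRHS]mulrDl -!mulrA.
  by apply: lerD; apply: ler_pM.
have hf' := germ_pred hf; have hg' := germ_pred hg.
case: hf hg => [Df fD fG] [Dg gD gG].
exists (fun x => f x *: Dg x + g x *: Df x).
  by apply: filterS2 fD gD => x; exact: sdiffM.
move=> i; have := germD (ih _ _ hf' (gG i)) (ih _ _ hg' (fG i)).
by apply: germ_ext; apply: near1W => x; rewrite !mxE.
Qed.

Lemma germZ k c f y : germ k y f -> germ k y (fun x => c * f x).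
Proof. exact: germM (germ_cst k c y). Qed.

Lemma germN k f y : germ k y f -> germ k y (fun x => - f x).
Proof.
by move/(germZ (-1)); apply: germ_ext; apply: near1W => x; rewrite mulN1r.
Qed.

Lemma germB k f g y : germ k y f -> germ k y g -> germ k y (fun x => f x - g x).
Proof. by move=> fk gk; exact: germD fk (germN gk). Qed.

Lemma germ_sum (I : Type) (r : seq I) (P : pred I) k (f : I -> V -> R) y :
  (forall i, P i -> germ k y (f i)) ->
  germ k y (fun x => \sum_(i <- r | P i) f i x).
Proof.
move=> h; elim: r => [|i r ih].
  apply: germ_ext (germ_cst k 0 y).
  by apply: near1W => x; rewrite big_nil.
have [Pi|Pi] := boolP (P i).
  apply: germ_ext (germD (h _ Pi) ih).
  by apply: near1W => x; rewrite big_cons Pi.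
by apply: germ_ext ih; apply: near1W => x; rewrite big_cons (negbTE Pi).
Qed.

End Class.

Section Composition.
Context {n m : nat}.
Local Notation V := 'rV[R]_n.
Implicit Types (y : V) (f : 'rV[R]_m -> R) (phi : V -> 'rV[R]_m).

Lemma lip_vec phi y : (forall i, lip (fun x => phi x 0 i) y) ->
  exists2 L, 0 < L &
    \forall p \near (y, y), `|phi p.1 - phi p.2| <= L * `|p.1 - p.2|.
Proof.
move=> /(_ _)/cid2 - /all_sig2[L L0 hL].
have h : \forall p \near (y, y), forall i,
    `|phi p.1 0 i - phi p.2 0 i| <= L i * `|p.1 - p.2|.
  exact: (@filter_forall _ _ _ (nbhs (y, y)) _ hL).
have SL0 : 0 <= \sum_i L i by apply: sumr_ge0 => i _; exact: ltW.
exists (1 + \sum_i L i); first by rewrite ltr_pwDl.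
apply: filterS h => p hp; apply: norm_le_coord => [|i j].
  by rewrite mulr_ge0// addr_ge0.
rewrite ord1 !mxE; apply: le_trans (hp j) _; rewrite ler_wpM2r//.
rewrite (bigD1 j)//= addrCA lerDl addr_ge0//.
by apply: sumr_ge0 => k _; exact: ltW.
Qed.

Lemma near_lip_vec phi y : (forall i, lip (fun x => phi x 0 i) y) ->
  \forall x \near y, forall i, lip (fun x => phi x 0 i) x.
Proof.
by move=> h; exact: (@filter_forall _ _ _ (nbhs y) _ (fun i => lip_near (h i))).
Qed.

Lemma germ0_comp f phi y : germ 0 (phi y) f ->
  (forall i, lip (fun x => phi x 0 i) y) -> germ 0 y (fun x => f (phi x)).
Proof.
move=> [fc [C C0 fC]] phil; have cphi := cvg_vec phil.
have [L L0 hL] := lip_vec phil; split.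
  apply: filterS2 (near_lip_vec phil) (cphi _ fc) => x /cvg_vec h1 h2.
  exact: cvg_comp h1 h2.
exists (C * L `^ alpha); first by rewrite mulr_ge0// powR_ge0.
have cphi2 := cvg_both cphi.
have h : \forall p \near (y, y), `|f (phi p.1) - f (phi p.2)| <=
    C * `|phi p.1 - phi p.2| `^ alpha by exact: (cphi2 _ fC).
apply: filterS2 h hL => p /= h1 h2; apply: le_trans h1 _.
rewrite -mulrA ler_wpM2l// -powRM ?(ltW L0)//.
exact: ge0_le_powR.
Qed.

(** The inner map has to be Lipschitz already at level 0: Lipschitz
substitutions preserve the Hoelder exponent, Hoelder ones do not. *)
Lemma germ_comp k f phi y : germ k (phi y) f ->
  (forall i, lip (fun x => phi x 0 i) y) ->
  (forall i, germ k y (fun x => phi x 0 i)) -> germ k y (fun x => f (phi x)).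
Proof.
move=> + phil; elim: k f => [f fk _|k ih f [Df fD fG] phiG].
  exact: germ0_comp.
have cphi := cvg_vec phil.
have /choice[D hD] : forall i, exists D : V -> V,
    (\forall x \near y, sdiff (fun x => phi x 0 i) x (D x)) /\
    forall j, germ k y (fun x => D x 0 j).
  by move=> i; have [D h1 h2] := phiG i; exists D.
have nD : \forall x \near y, forall i, sdiff (fun x => phi x 0 i) x (D i x).
  exact: (@filter_forall _ _ _ (nbhs y) _ (fun i => (hD i).1)).
exists (fun x => \sum_i Df (phi x) 0 i *: D i x).
  have fD' : \forall x \near y, sdiff f (phi x) (Df (phi x)) by exact: (cphi _ fD).
  by apply: filterS2 fD' nD => x; exact: sdiff_comp.
move=> j; apply: germ_ext (germ_sum (index_enum _) (P := xpredT)
    (f := fun i x => Df (phi x) 0 i * D i x 0 j) _).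
  apply: near1W => x; rewrite summxE; apply: eq_bigr => i _.
  by rewrite mxE.
move=> i _; apply: germM; last exact: (hD i).2.
by apply: (ih (fun z => Df z 0 i) (fG i)) => l; exact: germ_pred.
Qed.

(** The roles are exchanged with respect to [germ0_comp]: reciprocals and square
roots are Lipschitz functions, away from zero, of a quantity that is only
Hoelder continuous. *)
Lemma lip_comp_germ0 f phi y : lip f (phi y) ->
  (forall i, germ 0 y (fun x => phi x 0 i)) -> germ 0 y (fun x => f (phi x)).
Proof.
move=> fl phiG.
have phic : \forall x \near y, phi z @[z --> x] --> phi x.
  have h : \forall x \near y, forall i, phi z 0 i @[z --> x] --> phi x 0 i.
    exact: (@filter_forall _ _ _ (nbhs y) _ (fun i => (phiG i).1)).
  apply: filterS h => x h; apply: (@cvg_mx _ _ (nbhs x) _) => i j.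
  by rewrite ord1; exact: h.
have cphi := nbhs_singleton phic; split.
  have fl' : \forall x \near y, lip f (phi x) by exact: (cphi _ (lip_near fl)).
  apply: filterS2 phic fl' => x h1 /lip_cvg h2.
  exact: cvg_comp h1 h2.
case: fl => L L0 hL.
have /all_sig2[C C0 hC] := fun i => cid2 (phiG i).2.
have h : \forall p \near (y, y), forall i,
    `|phi p.1 0 i - phi p.2 0 i| <= C i * `|p.1 - p.2| `^ alpha.
  exact: (@filter_forall _ _ _ (nbhs (y, y)) _ hC).
have SC0 : 0 <= \sum_i C i by exact: sumr_ge0.
exists (L * \sum_i C i); first by rewrite mulr_ge0// ltW.
have cphi2 := cvg_both cphi.
have hf : \forall p \near (y, y), `|f (phi p.1) - f (phi p.2)| <=
    L * `|phi p.1 - phi p.2| by exact: (cphi2 _ hL).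
apply: filterS2 h hf => p hp /= /le_trans; apply.
rewrite -mulrA ler_pM2l//; apply: norm_le_coord => [|i j].
  by rewrite mulr_ge0// powR_ge0.
rewrite ord1 !mxE; apply: le_trans (hp j) _; rewrite ler_wpM2r ?powR_ge0//.
by rewrite (bigD1 j)//= lerDl sumr_ge0.
Qed.

End Composition.

Section Scalar.
Context {n : nat}.
Local Notation V := 'rV[R]_n.
Implicit Types (x y v : V) (f g : V -> R).

(** The function h of one real variable is passed as a function on row vectors of
length one, where the rules of strict differentiation provide the Lipschitz
bound. *)
Lemma germ0_scalar (h : R -> R) f y :
  lip (fun u : 'rV[R]_1 => h (dotv u (delta_mx 0 0))) (\row__ f y) ->
  germ 0 y f -> germ 0 y (fun x => h (f x)).
Proof.
move=> hl fG; have := @lip_comp_germ0 n 1 _ (fun x => \row__ f x) y hl.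
have E : \forall x \near y, f x = (\row__ f x : 'rV_1) 0 0.
  by apply: near1W => x; rewrite mxE.
move=> G; apply: germ_ext (G _).
  by apply: near1W => x; rewrite dotvC dotv_delta mxE.
by move=> i; rewrite ord1; exact: germ_ext E fG.
Qed.

Lemma germV k f y : f y != 0 -> germ k y f -> germ k y (fun x => (f x)^-1).
Proof.
move=> fy0; elim: k => [|k ih] fG.
  apply: germ0_scalar fG; apply: sdiff_lip.
  apply: (@sdiffV _ _ _ _ (delta_mx 0 0)); last exact: sdiff_dot.
  by rewrite dotvC dotv_delta mxE.
have fi := ih (germ_pred fG); have fc := germ_cvg fG.
have nf : \forall x \near y, f x != 0 by exact: cvgr_neq0 _ fc fy0.
case: fG => Df fD DG; exists (fun x => - (f x) ^- 2 *: Df x).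
  by apply: filterS2 nf fD => x; exact: sdiffV.
move=> i; apply: germ_ext (germN (germM (germM fi fi) (DG i))).
by apply: near1W => x; rewrite !mxE expr2 invfM mulNr.
Qed.

Lemma germ_sqrt k f y : 0 < f y -> germ k y f ->
  germ k y (fun x => Num.sqrt (f x)).
Proof.
move=> fy0; elim: k => [|k ih] fG.
  apply: germ0_scalar fG; apply: sdiff_lip.
  apply: (@sdiff_sqrt _ _ _ _ (delta_mx 0 0)); last exact: sdiff_dot.
  by rewrite dotvC dotv_delta mxE.
have fi := ih (germ_pred fG); have fc := germ_cvg fG.
have nf : \forall x \near y, 0 < f x by exact: cvgr_gt _ fc _ fy0.
case: fG => Df fD DG; exists (fun x => (2 * Num.sqrt (f x))^-1 *: Df x).
  by apply: filterS2 nf fD => x; exact: sdiff_sqrt.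
move=> i; apply: germ_ext (germM (germV _ (germZ 2 fi)) (DG i)).
  by apply: near1W => x; rewrite !mxE.
by rewrite mulf_neq0// gt_eqF// sqrtr_gt0.
Qed.

End Scalar.
End Germs.

(** * Germs and Hoelder classes on balls *)

Section HolderClass.
Context {R : realType} {n : nat}.
Local Notation V := 'rV[R]_n.
Implicit Types (x y v : V) (f g : V -> R).

(** Continuity at y alone bounds the oscillation near y. *)
Lemma continuous_germ0 f y : (\forall x \near y, f z @[z --> x] --> f x) ->
  germ 0 0 y f.
Proof.
move=> fc; split=> //; exists 1 => //.
have := nbhs_singleton fc => /(cvgr_dist_lt _ _).
move=> /(_ (2^-1) ltac:(by rewrite invr_gt0)) h.
apply: filterS2 (near_fst h) (near_snd h) => p h1 h2.
rewrite powRr0 mulr1 (_ : f p.1 - f p.2 = (f y - f p.2) - (f y - f p.1)); last by ring.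
by apply: le_trans (ler_normB _ _) _; lra.
Qed.

Lemma germ_exponent0 alpha k f y : germ alpha k y f -> germ 0 k y f.
Proof.
elim: k f => [f [fc _]|k ih f [Df fD fG]]; first exact: continuous_germ0.
by exists Df => // i; exact/ih/fG.
Qed.

Lemma eball_sub_near y (P : V -> Prop) : (\forall x \near y, P x) ->
  \forall r \near (0:R)^'+, forall x, eball y r x -> P x.
Proof.
move=> /nbhs_eball[e e0 h]; near=> r => x yx; apply: h.
by apply: lt_le_trans yx _; near: r; exact: nbhs_right_le.
Unshelve. all: by end_near. Qed.

Lemma germ_holder_class alpha k f y : 0 <= alpha <= 1 -> germ alpha k y f ->
  \forall r \near (0:R)^'+, holder_class k alpha (eball y r) f.
Proof.
move=> a01; elim: k f => [f [fc [C C0 fC]]|k ih f fG].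
  have [[P1 P2] [/= h1 h2] hP] := fC.
  near=> r; split.
    move=> x; rewrite inE => yx.
    by move: x yx; near: r; exact: eball_sub_near.
  move=> a0; exists C => x z yx yz.
  have : P1 x by move: x yx; near: r; exact: eball_sub_near.
  have : P2 z by move: z yz; near: r; exact: eball_sub_near.
  move=> Pz Px; have /= := hP (x, z) (conj Px Pz) => /le_trans; apply.
  by rewrite ler_wpM2l// ge0_le_powR// norm_le_enorm.
have [Df fD DfG] := fG.
have hi i : \forall r \near (0:R)^'+, holder_class k alpha (eball y r) (pderiv i f).
  apply: ih; apply: germ_ext (DfG i).
  by apply: filterS fD => x /sdiff_pderiv ->.
near=> r; split.
  move=> x; rewrite inE => yx; apply: (@sdiff_cvg _ _ _ _ (Df x)).
  by move: x yx; near: r; exact: eball_sub_near.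
move=> i; split; last first.
  by move: i; near: r; exact: filter_forall.
move=> x yx; have : sdiff f x (Df x).
  by move: x yx; near: r; exact: eball_sub_near.
by move=> /(sdiff_derive (delta_mx 0 i)) [].
Unshelve. all: by end_near. Qed.

(** The partial derivatives of f are continuous since they belong to the class of
order k, so that [sdiff_partials] applies at every point near y. *)
Lemma holder_class_germ alpha k f y (A : set V) : 0 <= alpha <= 1 ->
  (\forall x \near y, A x) -> holder_class k alpha A f -> germ alpha k y f.
Proof.
move=> a01 yA; elim: k f => [f [fc fH]|k ih f [fc fG]].
  have fc' : \forall x \near y, f z @[z --> x] --> f x.
    by apply: filterS yA => x Ax; apply: fc; rewrite inE.
  have [a0|a0] := ltP 0 alpha; last first.
    have -> : alpha = 0 by apply/eqP; rewrite eq_le a0; case/andP: a01.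
    exact: continuous_germ0.
  split => //; have [C hC] := fH a0.
  exists (`|C| * n.+1%:R `^ alpha); first by rewrite mulr_ge0// powR_ge0.
  apply: filterS2 (near_fst yA) (near_snd yA) => p h1 h2.
  apply: le_trans (hC _ _ h1 h2) _.
  rewrite -mulrA -powRM//; apply: le_trans (ler_wpM2r (powR_ge0 _ _) (ler_norm C)) _.
  by rewrite ler_wpM2l// ge0_le_powR ?enorm_ge0// enorm_le_norm.
exists (fun x => \row_i pderiv i f x); last first.
  move=> i; apply: (germ_ext (f := pderiv i f)).
    by apply: near1W => x; rewrite mxE.
  exact: ih (fG i).2.
apply: filterS (near_join yA) => x xA.
apply: (@sdiff_partials _ _ f (fun i => pderiv i f)).
  by apply: filterS xA => z zA i; apply: DeriveDef => //; exact: (fG i).1.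
move=> i; have [_] := fG i; case: (k) => [|k'] [h _]; apply: h; rewrite inE;
  exact: nbhs_singleton xA.
Qed.

End HolderClass.

(** * An implicit function along a fixed direction *)

Section Implicit.
Context {R : realType} {n : nat}.
Local Notation V := 'rV[R]_n.
Implicit Types (x y v q : V) (F tau : V -> R).

Definition shift_along q tau x := x - tau x *: q.

Lemma nbhs2_dist y (P : V * V -> Prop) : (\forall p \near (y, y), P p) ->
  exists2 e, 0 < e & forall a b, `|a - y| < e -> `|b - y| < e -> P (a, b).
Proof.
move=> [[P1 P2] [/= /nbhs_dist[e1 e10 h1] /nbhs_dist[e2 e20 h2]] hP].
exists (Num.min e1 e2); first by rewrite lt_min e10.
move=> a b; rewrite !lt_min => /andP[a1 _] /andP[_ b2].
by apply: hP; split; [exact: h1|exact: h2].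
Qed.

(** The slope of F in the direction q stays close to <q, v>. *)
Lemma sdiff_monotone F y q v : sdiff F y v -> 0 < dotv q v ->
  \forall p \near (y, y), forall t : R, p.1 - p.2 = t *: q ->
    exists2 c, dotv q v / 2 < c & F p.1 - F p.2 = t * c.
Proof.
move=> [W Wv FW] qv; have qW : dotv q (W p) @[p --> (y, y)] --> dotv q v.
  by apply: cvg_dotv => //; exact: cvg_cst.
have h : \forall p \near (y, y), dotv q v / 2 < dotv q (W p).
  by apply: (cvgr_gt _ qW); lra.
apply: filterS2 h FW => p h Fp t pt; exists (dotv q (W p)) => //.
by rewrite Fp pt dotvZl.
Qed.

Lemma cvg_line x q (t : R) : x - s *: q @[s --> t] --> x - t *: q.
Proof.
apply: cvgB; first exact: cvg_cst.
by apply: cvgZ; [exact: cvg_id|exact: cvg_cst].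
Qed.

Lemma cvg_along F x q (t : R) : F z @[z --> x - t *: q] --> F (x - t *: q) ->
  F (x - s *: q) @[s --> t] --> F (x - t *: q).
Proof.
exact: (@cvg_comp _ _ _ (fun s : R => x - s *: q) F _ _ _ (@cvg_line x q t)).
Qed.

Lemma cvg_shift q tau x : tau z @[z --> x] --> tau x ->
  shift_along q tau z @[z --> x] --> shift_along q tau x.
Proof.
move=> tx; apply: (@cvgB _ _ _ (nbhs x)); first exact: cvg_id.
by apply: (@cvgZ _ _ _ (nbhs x)) => //; exact: cvg_cst.
Qed.

Lemma sdiff_shift q tau x v i : sdiff tau x v ->
  sdiff (fun z => shift_along q tau z 0 i) x (delta_mx 0 i - q 0 i *: v).
Proof.
move=> tv; have := sdiffD (sdiff_dot (delta_mx 0 i) x) (sdiffZ (- q 0 i) tv).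
rewrite scaleNr; apply: sdiff_ext; apply: near1W => z.
by rewrite dotvC dotv_delta !mxE mulNr [q 0 i * _]mulrC.
Qed.

(** With a slope W of F at the shifted points, F = 0 at both of them reads
<x - x', W> = (tau x - tau x') <q, W>; dividing by <q, W> gives a slope of tau. *)
Lemma sdiff_implicit F q tau x v : tau z @[z --> x] --> tau x ->
  (\forall z \near x, F (shift_along q tau z) = 0) ->
  sdiff F (shift_along q tau x) v -> dotv q v != 0 ->
  sdiff tau x ((dotv q v)^-1 *: v).
Proof.
move=> /(cvg_shift (q := q))/cvg_both c2 F0 [W Wv FW] qv0.
set Z := fun p : V * V => W (shift_along q tau p.1, shift_along q tau p.2).
have cW : Z p @[p --> (x, x)] --> v by exact: cvg_comp c2 Wv.
have cqW : dotv q (Z p) @[p --> (x, x)] --> dotv q v.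
  by apply: cvg_dotv => //; exact: cvg_cst.
have nz : \forall p \near (x, x), dotv q (Z p) != 0 by exact: (cvgr_neq0 _ cqW).
exists (fun p => (dotv q (Z p))^-1 *: Z p).
  by apply: cvgZ => //; exact: cvgV.
have FZ : \forall p \near (x, x), F (shift_along q tau p.1) - F (shift_along q tau p.2)
    = dotv (shift_along q tau p.1 - shift_along q tau p.2) (Z p).
  exact: (c2 _ FW).
apply: filterS2 (filterI (near_fst F0) (near_snd F0)) (filterI FZ nz) => p [Fp1 Fp2] [Fp {}nz].
rewrite dotvZr; apply: (mulfI nz); rewrite mulrA mulfV// mul1r.
move: Fp; rewrite Fp1 Fp2 subr0 /shift_along !dotvBl !dotvZl => Fp.
by lra.
Qed.

(** Existence of tau is the intermediate value theorem on each line of direction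
q, along which F increases at a rate above m = <q, DF y> / 2; so |tau| is at most
|F| / m, which gives continuity at y, and [sdiff_implicit] gives the rest. *)
Lemma implicit_shift F (DF : V -> V) q y : F y = 0 ->
  (\forall x \near y, sdiff F x (DF x)) -> DF x @[x --> y] --> DF y ->
  0 < dotv q (DF y) ->
  exists tau : V -> R, [/\ tau y = 0,
    \forall x \near y, F (shift_along q tau x) = 0 &
    \forall x \near y, sdiff tau x ((dotv q (DF (shift_along q tau x)))^-1 *:
      DF (shift_along q tau x))].
Proof.
move=> Fy0 FD DFc qDF; set m := dotv q (DF y) / 2.
have m0 : 0 < m by rewrite divr_gt0.
have FDy := nbhs_singleton FD.
(* in the ball of radius e1 the function F grows along q at a rate above m *)
have [e1 e10 mono] := nbhs2_dist (sdiff_monotone FDy qDF).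
have [e2 e20 FDe] := nbhs_dist FD.
pose e := Num.min e1 e2; have e0 : 0 < e by rewrite lt_min e10.
have ee1 : e <= e1 by rewrite ge_min lexx.
(* half of e is left for x, the other half for a shift by at most d *)
pose d := e / 2 / (`|q| + 1).
have q1 : 0 < `|q| + 1 by rewrite ltr_wpDl.
have d0 : 0 < d by rewrite !divr_gt0.
have close x (t : R) : `|x - y| < e / 2 -> `|t| <= d -> `|x - t *: q - y| < e.
  move=> xe td; rewrite addrAC; apply: le_lt_trans (ler_normB _ _) _.
  rewrite normrZ (splitr e) ltr_leD//.
  apply: (@le_trans _ _ (d * (`|q| + 1))); last by rewrite divfK ?gt_eqF.
  by apply: ler_pM => //; rewrite lerDl.
have Fcont x : `|x - y| < e -> F z @[z --> x] --> F x.
  by rewrite lt_min => /andP[_ /FDe/sdiff_cvg].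
have yy0 : `|y - y| < e / 2 by rewrite subrr normr0 divr_gt0.
have monoe x t : `|x - y| < e / 2 -> `|t| <= d ->
    exists2 c, m < c & F x - F (x - t *: q) = t * c.
  move=> xe td; have := mono x (x - t *: q) _ _ t; apply.
  - by apply: lt_le_trans ee1; apply: lt_trans xe _; rewrite gtr_pMr// invf_lt1 ?ltr1n.
  - exact: lt_le_trans (close _ _ xe td) ee1.
  - by rewrite /= opprB addrC subrK.
have dd : `|d| <= d by rewrite ger0_norm// ltW.
have Fm : F (y - d *: q) < 0.
  have [c mc] := monoe y d yy0 dd; rewrite Fy0 sub0r => E.
  by rewrite -oppr_gt0 E mulr_gt0// (lt_trans m0).
have Fp : 0 < F (y - (- d) *: q).
  have [|c mc] := monoe y (- d) yy0; first by rewrite normrN.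
  rewrite Fy0 sub0r mulNr => /oppr_inj ->.
  by rewrite mulr_gt0// (lt_trans m0).
have cl (t : R) : x - t *: q @[x --> y] --> y - t *: q.
  by apply: (@cvgB _ _ _ (nbhs y)); [exact: cvg_id|exact: cvg_cst].
have Fm' : \forall x \near y, F (x - d *: q) < 0.
  have h : F (x - d *: q) @[x --> y] --> F (y - d *: q).
    exact: cvg_comp (cl d) (Fcont _ (close _ _ yy0 dd)).
  exact: (cvgr_lt _ h).
have Fp' : \forall x \near y, 0 < F (x - (- d) *: q).
  have nd : `|- d| <= d by rewrite normrN.
  have h : F (x - (- d) *: q) @[x --> y] --> F (y - (- d) *: q).
    exact: cvg_comp (cl (- d)) (Fcont _ (close _ _ yy0 nd)).
  exact: (cvgr_gt _ h).
have [e3 e30 he3] := nbhs_dist (filterI Fm' Fp').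
have /choice[tau htau] : forall x, exists t, `|x - y| < Num.min e3 (e / 2) ->
    `|t| <= d /\ F (x - t *: q) = 0.
  move=> x; have [xe|] := boolP (`|x - y| < _); last by exists 0.
  move: xe; rewrite lt_min => /andP[/he3[Fmx Fpx] xe].
  have [|||t] := @IVT R (fun t => F (x - t *: q)) (- d) d 0.
  - by rewrite ge0_cp// ltW.
  - have : {in `[- d, d]%classic, continuous (fun t : R => F (x - t *: q))}.
      move=> t; rewrite inE/= in_itv/= -ler_norml => td.
      exact: cvg_along (Fcont _ (close _ _ xe td)).
    exact: continuous_in_subspaceT.
  - by rewrite ge_min le_max (ltW Fmx) (ltW Fpx) orbT.
  - by rewrite in_itv/= -ler_norml => td Ft; exists t.
(* tau solves the equation in the ball of radius e4 and is arbitrary elsewhere *)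
pose e4 := Num.min e3 (e / 2).
have e40 : 0 < e4 by rewrite lt_min e30 divr_gt0.
have tau_bound x : `|x - y| < e4 -> `|tau x| <= m^-1 * `|F x|.
  move=> xe; have [td Ft] := htau x xe.
  have xe2 : `|x - y| < e / 2 by move: xe; rewrite lt_min => /andP[].
  have [c mc] := monoe x (tau x) xe2 td; rewrite Ft subr0 => ->.
  have c0 := lt_trans m0 mc.
  by rewrite ler_pdivlMl// normrM mulrC ler_wpM2l// ger0_norm ltW.
have tauy : tau y = 0.
  apply/eqP; rewrite -normr_le0; have := tau_bound y.
  by rewrite Fy0 normr0 mulr0 subrr normr0; apply.
have near4 : \forall x \near y, `|x - y| < e4.
  by apply: filterS (nbhsx_ballx y _ e40) => x; rewrite -ball_normE/= distrC.
have F0 : \forall x \near y, F (shift_along q tau x) = 0.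
  by apply: filterS near4 => x /htau[].
have tauc : tau x @[x --> y] --> tau y.
  rewrite tauy; apply/(@cvgr0Pnorm_le _ _ _ (nbhs y)) => d' d'0.
  have me : 0 < m * d' by rewrite mulr_gt0.
  have Fc := sdiff_cvg FDy; rewrite Fy0 in Fc.
  have h : \forall x \near y, `|F x| <= m * d' by exact: (cvgr0_norm_le _ Fc _ me).
  apply: filterS2 near4 h => x /tau_bound/le_trans h1 h2; apply: h1.
  by rewrite ler_pdivrMl.
have shy : shift_along q tau y = y by rewrite /shift_along tauy scale0r subr0.
have tauD : sdiff tau y ((dotv q (DF y))^-1 *: DF y).
  by apply: (sdiff_implicit (F := F)); rewrite ?shy// gt_eqF.
have tau_lip := lip_near (sdiff_lip tauD).
exists tau; split => //.
have shc := cvg_shift (q := q) tauc; rewrite shy in shc.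
have FDs : \forall x \near y, sdiff F (shift_along q tau x) (DF (shift_along q tau x)).
  exact: (shc _ FD).
have qDFs : \forall x \near y, 0 < dotv q (DF (shift_along q tau x)).
  have c1 : dotv q (DF (shift_along q tau x)) @[x --> y] --> dotv q (DF y).
    by apply: (@cvg_dotv _ _ (nbhs y)); [exact: cvg_cst|exact: cvg_comp shc DFc].
  exact: (cvgr_gt _ c1).
apply: filterS3 (filterI (near_join F0) tau_lip) FDs qDFs => x [Fx /lip_cvg tx] h1 h2.
by apply: sdiff_implicit Fx h1 _ => //; rewrite gt_eqF.
Qed.

Lemma germ_shift alpha k q tau y i : 0 <= alpha <= 1 -> germ alpha k y tau ->
  germ alpha k y (fun x => shift_along q tau x 0 i).
Proof.
move=> a01 tG; apply: germ_ext (germB a01 (germ_coord a01 k i y) (germZ a01 (q 0 i) tG)).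
by apply: near1W => x; rewrite !mxE mulrC.
Qed.

(** The implicit equation expresses the gradient of tau through DF and tau itself,
so that each known order of smoothness of tau yields the next one. *)
Lemma germ_implicit alpha k (DF : V -> V) q tau y : 0 <= alpha <= 1 ->
  tau y = 0 -> 0 < dotv q (DF y) ->
  (forall i, germ alpha k y (fun x => DF x 0 i)) ->
  (\forall x \near y, sdiff tau x ((dotv q (DF (shift_along q tau x)))^-1 *:
      DF (shift_along q tau x))) ->
  germ alpha k.+1 y tau.
Proof.
move=> a01 tauy qDF DFG tauD.
have shy : shift_along q tau y = y by rewrite /shift_along tauy scale0r subr0.
suff : forall j, (j <= k.+1)%N -> germ alpha j y tau by apply.
elim=> [_|j ih jk]; first exact/lip_germ0/sdiff_lip/(nbhs_singleton tauD).
have tG := ih (ltnW jk).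
have DFs i : germ alpha j y (fun x => DF (shift_along q tau x) 0 i).
  apply: (@germ_comp _ _ a01 n n j (fun x => DF x 0 i)).
  - by rewrite shy; exact: germ_le (DFG i).
  - by move=> l; exact: sdiff_lip (sdiff_shift q l (nbhs_singleton tauD)).
  - by move=> l; exact: germ_shift.
exists (fun x => (dotv q (DF (shift_along q tau x)))^-1 *: DF (shift_along q tau x)) => //.
move=> i; apply: germ_ext (germM a01 (germV a01 (f := fun x =>
  \sum_l q 0 l * DF (shift_along q tau x) 0 l) _ _) (DFs i)).
- by apply: near1W => x; rewrite !mxE.
- by rewrite shy gt_eqF.
- by apply: germ_sum => // l _; exact: germZ.
Qed.

End Implicit.

(** * Inverting maps with derivative the identity *)

HB.instance Definition _ (R : realType) (m n : nat) :=
  Uniform_isComplete.Build (matrix R m n) cauchy_cvg.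

Section Inverse.
Context {R : realType} {n : nat}.
Local Notation V := 'rV[R]_n.
Implicit Types (x y v : V) (Phi Psi : V -> V) (J : 'M[R]_n).

Lemma contraction_fixed_point (U : set V) (f : V -> V) : closed U -> U !=set0 ->
  (forall a, U a -> U (f a)) ->
  (forall a b, U a -> U b -> `|f a - f b| <= 2^-1 * `|a - b|) ->
  exists2 p, U p & p = f p.
Proof.
move=> Ucl U0 fU fc; have fU' : {homo f : x / U x >-> U x} by exact: fU.
apply: (@banach_fixed_point R (matrix R 1 n) U (mkfun_fun fU') _ Ucl U0).
have h0 : 0 <= 2^-1 :> R by rewrite invr_ge0.
exists (NngNum h0); split; first by rewrite /= invf_lt1 ?ltr1n.
by move=> [a b] [/= Ua Ub]; exact: fc.
Qed.

Lemma norm_mulmx (x : V) (M : 'M[R]_n) : `|x *m M| <= n%:R * `|x| * `|M|.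
Proof.
apply: norm_le_coord; first by rewrite !mulr_ge0.
move=> i j; rewrite mxE; apply: le_trans (ler_norm_sum _ _ _) _.
apply: (@le_trans _ _ (\sum_(i < n) `|x| * `|M|)).
  by apply: ler_sum => k _; rewrite normrM ler_pM// coord_le_norm.
by rewrite sumr_const card_ord -mulrA mulr_natl.
Qed.

(** The slope of a map is a matrix acting on rows.  For an inverse map the slope
is the inverse matrix, which is how strict differentiability passes to inverses. *)
Definition msdiff Phi x J := exists2 W : V * V -> 'M[R]_n,
  W p @[p --> (x, x)] --> J &
  \forall p \near (x, x), Phi p.1 - Phi p.2 = (p.1 - p.2) *m W p.

Lemma msdiff_coord Phi x J i : msdiff Phi x J ->
  sdiff (fun z => Phi z 0 i) x (col i J)^T.
Proof.
move=> [W WJ PW]; exists (fun p => (col i (W p))^T).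
  apply: (@cvg_mx _ _ (nbhs (x, x)) _) => k j; rewrite !mxE.
  by under eq_fun do rewrite !mxE; exact: cvg_coord.
apply: filterS PW => p /rowP/(_ i); rewrite !mxE => ->.
by apply: eq_bigr => k _; rewrite !mxE.
Qed.

Lemma coord_msdiff Phi x (D : 'I_n -> V) :
  (forall i, sdiff (fun z => Phi z 0 i) x (D i)) ->
  msdiff Phi x (\matrix_(j, i) D i 0 j).
Proof.
move=> PD.
have /choice[Z hZ] : forall i, exists Z : V * V -> V,
    Z p @[p --> (x, x)] --> D i /\
    \forall p \near (x, x), Phi p.1 0 i - Phi p.2 0 i = dotv (p.1 - p.2) (Z p).
  by move=> i; have [Z h1 h2] := PD i; exists Z.
exists (fun p => \matrix_(j, i) Z i p 0 j).
  apply: (@cvg_mx _ _ (nbhs (x, x)) _) => k j; rewrite !mxE.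
  by under eq_fun do rewrite !mxE; apply: cvg_coord; exact: (hZ j).1.
have h : \forall p \near (x, x), forall i,
    Phi p.1 0 i - Phi p.2 0 i = dotv (p.1 - p.2) (Z i p).
  exact: (@filter_forall _ _ _ (nbhs (x, x)) _ (fun i => (hZ i).2)).
apply: filterS h => p h; apply/rowP => i; rewrite !mxE h.
by apply: eq_bigr => k _; rewrite !mxE.
Qed.

Lemma msdiff_cvg Phi x J : msdiff Phi x J -> Phi z @[z --> x] --> Phi x.
Proof.
by move=> PJ; apply: cvg_vec => i; exact: sdiff_lip (msdiff_coord i PJ).
Qed.

Lemma msdiff_inverse Phi Psi x J : Psi z @[z --> x] --> Psi x ->
  (\forall z \near x, Phi (Psi z) = z) -> msdiff Phi (Psi x) J ->
  J \in unitmx -> msdiff Psi x (invmx J).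
Proof.
move=> /cvg_both c2 PP [W WJ PW] Ju.
pose Z p := W (Psi p.1, Psi p.2).
have ZJ : Z p @[p --> (x, x)] --> J by exact: cvg_comp c2 WJ.
exists (fun p => invmx (Z p)); first exact: cvg_invmx.
have Zu : \forall p \near (x, x), Z p \in unitmx by exact: cvg_unitmx ZJ.
have PZ : \forall p \near (x, x), Phi (Psi p.1) - Phi (Psi p.2) =
    (Psi p.1 - Psi p.2) *m Z p by exact: (c2 _ PW).
apply: filterS2 (filterI (near_fst PP) (near_snd PP)) (filterI Zu PZ).
move=> p [h1 h2] [h3 h4].
by have -> : p.1 - p.2 = (Psi p.1 - Psi p.2) *m Z p;
  [rewrite -h4 h1 h2|rewrite mulmxK].
Qed.

(** Near y the map z |-> z - Phi z has Lipschitz constant 1/2, so that the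
equation Phi z = x is the fixed point problem z = x + (z - Phi z). *)
Lemma local_inverse Phi y : Phi y = y -> msdiff Phi y 1%:M ->
  exists Psi : V -> V, [/\ Psi y = y, Psi x @[x --> y] --> y,
    \forall x \near y, Phi (Psi x) = x & \forall x \near y, Psi (Phi x) = x].
Proof.
move=> Py [W W1 PW].
have c0 : 0 < (2 * n.+1%:R)^-1 :> R by rewrite invr_gt0.
have /nbhs2_dist[e e0 contr] : \forall p \near (y, y),
    `|(p.1 - Phi p.1) - (p.2 - Phi p.2)| <= 2^-1 * `|p.1 - p.2|.
  have h : \forall p \near (y, y), `|1%:M - W p| <= (2 * n.+1%:R)^-1.
    exact: (cvgr_dist_le _ _ W1).
  apply: filterS2 PW h => p Pp hp.
  have -> : (p.1 - Phi p.1) - (p.2 - Phi p.2) = (p.1 - p.2) *m (1%:M - W p).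
    by rewrite mulmxBr mulmx1 -Pp; apply/rowP => i; rewrite !mxE; ring.
  apply: le_trans (norm_mulmx _ _) _; rewrite mulrAC -mulrA [_ * `|p.1 - p.2|]mulrC mulrCA.
  (* the bound on the entries of 1 - W was chosen to make this product 1/2;
     n.+1 instead of n avoids a zero denominator *)
  rewrite mulrC ler_wpM2r//; apply: (@le_trans _ _ (n.+1%:R * (2 * n.+1%:R)^-1)).
    by apply: ler_pM => //; rewrite ler_nat.
  by rewrite invfM mulrCA mulfV ?mulr1.
have e2 : 0 < e / 2 by rewrite divr_gt0.
have e4 : 0 < e / 4 by rewrite divr_gt0.
have /choice[Psi hPsi] : forall x, exists z, `|x - y| <= e / 4 ->
    `|z - y| <= e / 2 /\ Phi z = x.
  move=> x; have [xe|] := boolP (`|x - y| <= e / 4); last by exists 0.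
  have [||a|a b|p] := @contraction_fixed_point
    [set z | `|z - y| <= e / 2] (fun z => x + (z - Phi z)).
  - rewrite (_ : [set z | _] = closed_ball_ Num.Def.normr y (e / 2)).
      exact: closed_closed_ball_.
    by apply/seteqP; split => z /=; rewrite distrC.
  - by exists y; rewrite /= subrr normr0 ltW.
  - rewrite /= => ae; have ae' : `|a - y| < e by lra.
    have ye : `|y - y| < e by rewrite subrr normr0.
    have := contr _ _ ae' ye; rewrite /= Py subrr subr0 => h.
    rewrite addrAC; apply: le_trans (ler_normD _ _) _.
    by apply: le_trans (lerD xe h) _; lra.
  - move=> /= ae be; rewrite opprD addrACA subrr add0r.
    by apply: (contr a b); lra.
  - move=> /= pe pE; exists p => _; split=> //.
    by move/eqP: pE; rewrite addrCA -subr_eq0 opprD addrA subrr add0r opprB subr_eq0 => /eqP.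
have lips a b : `|a - y| < e -> `|b - y| < e -> `|a - b| <= 2 * `|Phi a - Phi b|.
  move=> ae be; have /= h := contr a b ae be.
  have : `|a - b| <= `|(a - Phi a) - (b - Phi b)| + `|Phi a - Phi b|.
    rewrite -[in leLHS](_ : ((a - Phi a) - (b - Phi b)) + (Phi a - Phi b) = a - b).
      exact: ler_normD.
    by apply/rowP => i; rewrite !mxE; ring.
  by move=> h2; lra.
have near4 : \forall x \near y, `|x - y| <= e / 4.
  by apply: filterS (nbhsx_ballx y _ e4) => x; rewrite -ball_normE/= distrC => /ltW.
have yy c : 0 < c -> `|y - y| < c by rewrite subrr normr0.
have PsiB x : `|x - y| <= e / 4 -> `|Psi x - y| <= 2 * `|x - y|.
  move=> xe; have [h1 h2] := hPsi x xe.
  have := lips (Psi x) y _ (yy _ e0); rewrite h2 Py; apply; lra.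
have Psiy : Psi y = y.
  apply/eqP; rewrite -subr_eq0 -normr_le0.
  have := PsiB y; rewrite subrr normr0 mulr0; apply; exact: ltW.
have c1 : Psi x @[x --> y] --> y.
  apply/(@cvgrPdist_le _ _ _ (nbhs y)) => d d0.
  have d2 : 0 < d / 2 by rewrite divr_gt0.
  apply: filterS2 near4 (near_dist y d2) => x /PsiB h1 h2.
  by rewrite distrC; rewrite distrC in h2; lra.
exists Psi; split => //.
  by apply: filterS near4 => x /hPsi[].
have Pc : Phi x @[x --> y] --> Phi y.
  by apply: (@msdiff_cvg _ _ 1%:M); exists W.
rewrite Py in Pc.
have near4' : \forall x \near y, `|Phi x - y| <= e / 4 by exact: (Pc _ near4).
apply: filterS2 near4 near4' => x h1 h2; have [h3 h4] := hPsi _ h2.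
apply/eqP; rewrite -subr_eq0 -normr_le0; apply: le_trans (lips _ _ _ _) _; try lra.
by rewrite h4 subrr normr0 mulr0.
Qed.

(** The derivative of Psi at x is the inverse of the matrix J (Psi x), which is
continuous in x. *)
Lemma local_inverse_C1 Phi (J : V -> 'M[R]_n) y : Phi y = y -> J y = 1%:M ->
  (\forall x \near y, msdiff Phi x (J x)) ->
  (\forall x \near y, J z @[z --> x] --> J x) ->
  exists Psi : V -> V, [/\ Psi y = y,
    \forall x \near y, Phi (Psi x) = x /\ Psi (Phi x) = x,
    \forall x \near y, J (Psi x) \in unitmx,
    \forall x \near y, msdiff Psi x (invmx (J (Psi x))) &
    forall i, germ 0 1 y (fun x => Psi x 0 i)].
Proof.
move=> Phiy Jy PhiJ Jc; have PhiJy := nbhs_singleton PhiJ; rewrite Jy in PhiJy.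
have [Psi [Psiy Psic PhiPsi PsiPhi]] := local_inverse Phiy PhiJy.
have JPc : J (Psi x) @[x --> y] --> (1%:M : 'M[R]_n).
  by rewrite -Jy; exact: cvg_comp Psic (nbhs_singleton Jc).
have JPu : \forall x \near y, J (Psi x) \in unitmx.
  by apply: cvg_unitmx JPc; exact: unitmx1.
have Psi_lip i : lip (fun x => Psi x 0 i) y.
  apply: sdiff_lip; apply: msdiff_coord.
  by apply: (msdiff_inverse (Phi := Phi)) PhiPsi _ (unitmx1 _ _); rewrite Psiy.
have Psic' : \forall x \near y, Psi z @[z --> x] --> Psi x.
  by apply: filterS (near_lip_vec Psi_lip) => x; exact: cvg_vec.
have PsiD : \forall x \near y, msdiff Psi x (invmx (J (Psi x))).
  have h : \forall x \near y, msdiff Phi (Psi x) (J (Psi x)) by exact: (Psic _ PhiJ).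
  apply: filterS2 (filterI (near_join PhiPsi) Psic') (filterI h JPu).
  by move=> x [h1 h2] [h3 h4]; exact: msdiff_inverse h1 h3 h4.
exists Psi; split => // [|i].
  by apply: filterS2 PhiPsi PsiPhi.
exists (fun x => (col i (invmx (J (Psi x))))^T).
  by apply: filterS PsiD => x; exact: msdiff_coord.
move=> j; apply: continuous_germ0.
have Jc' : \forall x \near y, J z @[z --> Psi x] --> J (Psi x) by exact: (Psic _ Jc).
apply: filterS3 Jc' Psic' JPu => x h1 h2 h3; rewrite !mxE.
under eq_fun do rewrite !mxE.
apply: (@cvg_coord _ _ (nbhs x) _); apply: (@cvg_invmx _ _ (nbhs x) _) => //.
exact: cvg_comp h2 h1.
Qed.

End Inverse.

(** * The signed Euclidean distance *)

Section SignedDistance.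
Context {R : realType} {n : nat}.
Local Notation V := 'rV[R]_n.
Implicit Types (x y v q : V) (F g : V -> R) (DF : V -> V).

Definition normalize (v : V) : V := (enorm v)^-1 *: v.

Lemma enorm_gt0 v : (0 < enorm v) = (v != 0).
Proof. by rewrite sqrtr_gt0 dotvv_gt0. Qed.

Lemma enorm_normalize v : v != 0 -> enorm (normalize v) = 1.
Proof.
rewrite -enorm_gt0 => v0.
by rewrite enormZ ger0_norm ?invr_ge0 ?enorm_ge0// mulVf// gt_eqF.
Qed.

Lemma germ_grad alpha k (f : V -> R) (D : V -> V) y i : germ alpha k.+1 y f ->
  (\forall x \near y, sdiff f x (D x)) -> germ alpha k y (fun x => D x 0 i).
Proof.
move=> [Df fDf DfG] fD; apply: germ_ext (DfG i).
by apply: filterS2 fD fDf => x h1 h2; rewrite (sdiff_uniq h1 h2).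
Qed.

Lemma germ_normalize alpha k DF y i : 0 <= alpha <= 1 -> DF y != 0 ->
  (forall i, germ alpha k y (fun x => DF x 0 i)) ->
  germ alpha k y (fun x => normalize (DF x) 0 i).
Proof.
move=> a01 DF0 DFG; apply: (@germ_ext _ _ _ _
    (fun x => (Num.sqrt (\sum_j DF x 0 j * DF x 0 j))^-1 * DF x 0 i)).
  by apply: near1W => x; rewrite mxE.
apply: (germM a01 _ (DFG i)); apply: germV => //.
  by rewrite gt_eqF// sqrtr_gt0 dotvv_gt0.
apply: germ_sqrt => //; first by rewrite dotvv_gt0.
by apply: germ_sum => // j _; exact: germM.
Qed.

(** Here foot x is the zero of F on whose normal x lies and g x the signed
time on it: x = foot x + g x *: Dg x.  Multiplying the differential of this
identity by the unit vector Dg x gives the gradient of g, because Dg x is normal to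
the displacements of foot x, and orthogonal to its own derivative. *)
Lemma signed_distance F DF y : F y = 0 -> DF y != 0 ->
  (\forall x \near y, sdiff F x (DF x)) ->
  (forall i, germ 0 1 y (fun x => DF x 0 i)) ->
  exists (g : V -> R) (Dg foot : V -> V),
    [/\ \forall x \near y, sdiff g x (Dg x) /\ enorm (Dg x) = 1,
        forall i, germ 0 1 y (fun x => Dg x 0 i),
        Dg y = normalize (DF y) /\ foot x @[x --> y] --> y,
        \forall x \near y, F (foot x) = 0 /\ x = foot x + g x *: Dg x &
        \forall x \near y, F x = 0 -> g x = 0].
Proof.
move=> Fy DF0 FD DFG; have a01 : 0 <= (0 : R) <= 1 by rewrite lexx ler01.
have DFc : DF x @[x --> y] --> DF y.
  by apply: cvg_vec => i; exact: germ_lip (DFG i).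
pose q := normalize (DF y).
have qDF : 0 < dotv q (DF y).
  by rewrite dotvZl mulr_gt0// ?invr_gt0 ?enorm_gt0// dotvv_gt0.
have [tau [tauy F0 tauD]] := implicit_shift Fy FD DFc qDF.
have tauG : germ 0 2 y tau by apply: (germ_implicit a01 tauy qDF).
set Dtau := fun x => (dotv q (DF (shift_along q tau x)))^-1 *: DF (shift_along q tau x) in tauD.
pose pr := shift_along q tau.
have pry : pr y = y by rewrite /pr /shift_along tauy scale0r subr0.
have pr_lip i : lip (fun x => pr x 0 i) y.
  exact: sdiff_lip (sdiff_shift q i (nbhs_singleton tauD)).
have prc := cvg_vec pr_lip; rewrite pry in prc.
(* the unit normal where the line of direction q through x meets the zeros of F *)
pose nh x := normalize (DF (pr x)).
have nhG i : germ 0 1 y (fun x => nh x 0 i).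
  apply: (@germ_comp _ _ a01 n n 1 (fun x => normalize (DF x) 0 i)) => //.
    by rewrite pry; exact: germ_normalize.
  by move=> l; apply: germ_shift => //; exact: germ_pred tauG.
have /choice[Dn hDn] : forall i, exists D : V -> V,
    \forall x \near y, sdiff (fun z => nh z 0 i) x (D x).
  by move=> i; have [D h1 h2] := nhG i; exists D.
have nDn : \forall x \near y, forall i, sdiff (fun z => nh z 0 i) x (Dn i x).
  exact: (@filter_forall _ _ _ (nbhs y) _ hDn).
(* moves the time tau x along the normal instead of the direction q; the two
   directions agree at y, whence the derivative 1 there *)
pose Phi x := pr x + tau x *: nh x.
pose DPhi i x := (delta_mx 0 i - q 0 i *: Dtau x) +
  (tau x *: Dn i x + nh x 0 i *: Dtau x) : V.
pose J x : 'M[R]_n := \matrix_(j, i) DPhi i x 0 j.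
have PhiJ : \forall x \near y, msdiff Phi x (J x).
  apply: filterS2 tauD nDn => x tx nx; apply: coord_msdiff => i.
  apply: sdiff_ext (sdiffD (sdiff_shift q i tx) (sdiffM tx (nx i))).
  by apply: near1W => z; rewrite !mxE.
have Jy : J y = 1%:M.
  apply/matrixP => j i; rewrite !mxE tauy /nh pry -/q mul0r add0r subrK eqxx/=.
  by [].
have Phiy : Phi y = y by rewrite /Phi tauy scale0r addr0.
have Jc : \forall x \near y, J z @[z --> x] --> J x.
  have h : \forall x \near y, forall i j, DPhi i z 0 j @[z --> x] --> DPhi i x 0 j.
    apply: (@filter_forall _ _ _ (nbhs y) _) => i.
    apply: (@filter_forall _ _ _ (nbhs y) _) => j.
    suff : germ 0 0 y (fun z => DPhi i z 0 j) by case.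
    have Dtj : germ 0 0 y (fun x => Dtau x 0 j).
      exact: germ_grad (germ_pred a01 tauG) tauD.
    have h2 := germD (germB a01 (germ_cst a01 0 ((delta_mx 0 i : V) 0 j) y)
      (germZ a01 (q 0 i) Dtj)) (germD (germM a01 (germ_le a01 (leq0n 2) tauG)
      (germ_grad j (nhG i) (hDn i))) (germM a01 (germ_pred a01 (nhG i)) Dtj)).
    by apply: germ_ext h2; apply: near1W => x; rewrite !mxE.
  apply: filterS h => x h; apply: (@cvg_mx _ _ (nbhs x) _) => i j; rewrite mxE.
  by under eq_fun do rewrite mxE; exact: h.
have [Psi [Psiy inv JPu PsiD PsiG]] := local_inverse_C1 Phiy Jy PhiJ Jc.
have Psi_lip i : lip (fun x => Psi x 0 i) y by exact: germ_lip (PsiG i).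
have Psic := cvg_vec Psi_lip; rewrite Psiy in Psic.
have DFpr0 : \forall x \near y, DF (pr x) != 0.
  have h : DF (pr x) @[x --> y] --> DF y by exact: cvg_comp prc DFc.
  exact: (cvgr_neq0 _ h).
have nh1 : \forall x \near y, enorm (nh x) = 1.
  by apply: filterS DFpr0 => x; exact: enorm_normalize.
have key : \forall z \near y, \sum_i nh z 0 i *: DPhi i z = Dtau z.
  have FDp : \forall x \near y, sdiff F (pr x) (DF (pr x)) by exact: (prc _ FD).
  apply: filterS3 (filterI (near_join F0) (near_join nh1)) (filterI tauD nDn) FDp.
  move=> z [Fz nz] [tz nDz] FDz.
  (* F (pr z) = 0: the normal annihilates the derivative of pr *)
  have E1 : \sum_i nh z 0 i *: (delta_mx 0 i - q 0 i *: Dtau z) = 0 :> V.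
    have /sdiff_uniq := sdiff_comp FDz (fun i => sdiff_shift q i tz).
    move=> /(_ _ (sdiff_ext _ (sdiff_cst 0 z))) E.
    rewrite (eq_bigr (fun i => (enorm (DF (pr z)))^-1 *: (DF (pr z) 0 i *:
      (delta_mx 0 i - q 0 i *: Dtau z)))) => [|i _]; last by rewrite [nh z 0 i]mxE -scalerA.
    rewrite -scaler_sumr E ?scaler0//.
    by apply: filterS Fz => x ->.
  (* the normal has constant length *)
  have E2 : \sum_i nh z 0 i *: Dn i z = 0.
    have /sdiff_uniq := sdiff_sum (index_enum _) (P := xpredT)
      (fun i _ => sdiffM (nDz i) (nDz i)).
    move=> /(_ _ (sdiff_ext _ (sdiff_cst 1 z))) E.
    have : 2 *: (\sum_i nh z 0 i *: Dn i z) = 0.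
      rewrite scaler_sumr -[RHS]E; last first.
        by apply: filterS nz => x; rewrite -[\sum_i _]/(dotv _ _) -sqr_enorm => ->; rewrite expr1n.
      by apply: eq_bigr => i _; rewrite scaler_nat mulr2n.
    by move=> /eqP; rewrite scaler_eq0 pnatr_eq0 => /eqP.
  rewrite (eq_bigr (fun i => nh z 0 i *: (delta_mx 0 i - q 0 i *: Dtau z) +
    (tau z *: (nh z 0 i *: Dn i z) + (nh z 0 i * nh z 0 i) *: Dtau z))); last first.
    by move=> i _; rewrite scalerDr; congr (_ + _); apply/rowP => j; rewrite !mxE; ring.
  rewrite !big_split/= E1 add0r -scaler_sumr E2 scaler0 add0r -scaler_suml.
  by rewrite -[\sum_i _]/(dotv _ _) -sqr_enorm (nbhs_singleton nz) expr1n scale1r.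
exists (fun x => tau (Psi x)), (fun x => nh (Psi x)), (fun x => pr (Psi x)).
split.
- have h1 : \forall x \near y, sdiff tau (Psi x) (Dtau (Psi x)) by exact: (Psic _ tauD).
  have h2 : \forall x \near y, enorm (nh (Psi x)) = 1 by exact: (Psic _ nh1).
  have h3 : \forall x \near y, \sum_i nh (Psi x) 0 i *: DPhi i (Psi x) = Dtau (Psi x).
    exact: (Psic _ key).
  apply: filterS3 (filterI h1 h2) h3 (filterI PsiD JPu) => x [tx nx] kx [px jx].
  split => //; have := sdiff_comp tx (fun i => msdiff_coord i px).
  have -> // : \sum_i Dtau (Psi x) 0 i *: (col i (invmx (J (Psi x))))^T = nh (Psi x).
  have E : Dtau (Psi x) = nh (Psi x) *m (J (Psi x))^T.
    rewrite -kx; apply/rowP => j; rewrite summxE mxE.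
    by apply: eq_bigr => i _; rewrite !mxE.
  have -> : nh (Psi x) = Dtau (Psi x) *m (invmx (J (Psi x)))^T.
    by rewrite E -mulmxA -trmx_mul mulVmx// trmx1 mulmx1.
  apply/rowP => j; rewrite summxE mxE.
  by apply: eq_bigr => i _; rewrite !mxE.
- move=> i; apply: (@germ_comp _ _ a01 n n 1 (fun x => nh x 0 i)) => //.
  by rewrite Psiy.
- split; first by rewrite Psiy /nh pry.
  exact: cvg_comp Psic prc.
- have h : \forall x \near y, F (pr (Psi x)) = 0 by exact: (Psic _ F0).
  by apply: filterS2 h inv => x h1 [h2 _]; split.
- have c1 : (x, pr x) @[x --> y] --> (y, y) by exact: cvg_pair cvg_id prc.
  have mono : \forall x \near y, forall t : R, x - pr x = t *: q ->
      exists2 c, dotv q (DF y) / 2 < c & F x - F (pr x) = t * c.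
    exact: (c1 _ (sdiff_monotone (nbhs_singleton FD) qDF)).
  apply: filterS3 mono F0 inv => x mx F0x [_ PPx] Fx.
  have taux : tau x = 0.
    have [|c c0] := mx (tau x); first by rewrite /pr /shift_along opprB addrC subrK.
    rewrite F0x Fx subrr => /esym/eqP; rewrite mulf_eq0 => /orP[/eqP//|/eqP c00].
    by move: c0; rewrite c00 ltNge divr_ge0// ltW.
  have Phix : Phi x = x by rewrite /Phi /pr /shift_along taux !scale0r subr0 addr0.
  by rewrite -[in Psi x]Phix PPx.
Qed.
End SignedDistance.

(** * Gauges, polars and normal cones *)

(** Meant for the gauge of the polar, which is linear near an interior point of a
normal cone. *)
Lemma near_linear_differentiable (R : realType) (V W : normedModType R)
    (f : V -> W) (L : {linear V -> W}) (x : V) :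
  continuous L -> (\forall z \near x, f z = L z) -> differentiable f x.
Proof.
move=> Lc fL; have E : f \o shift x = cst (f x) + L +o_ 0 id.
  apply/eqaddoP => e e0.
  have c0 : h + x @[h --> (0 : V)] --> x.
    rewrite -[X in _ --> X](add0r x).
    by apply: (@cvgD _ _ _ (nbhs (0 : V))); [exact: cvg_id|exact: cvg_cst].
  have fL' : \forall h \near (0 : V), f (h + x) = L (h + x) by exact: (c0 _ fL).
  apply: filterS fL' => h fh; rewrite !fctE /= fh (nbhs_singleton fL) linearD.
  by rewrite [L x + L h]addrC subrr normr0 mulr_ge0// ltW.
have dE : 'd f x = L :> (V -> W) by exact: diff_unique.
by apply/diff_locallyP; rewrite dE; split.
Qed.

Section Gauge.
Context {R : realType} {n : nat}.
Local Notation V := 'rV[R]_n.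
Implicit Types (x y v p : V) (K : set V).

Lemma gauge_ge0 K x : 0 <= gauge_fun K x.
Proof.
rewrite /gauge_fun; set A := (X in inf X).
have [->|/set0P A0] := eqVneq A set0; first by rewrite inf0.
by apply: lb_le_inf => // l [/ltW].
Qed.

Lemma gauge_le K x l : 0 < l -> K (l^-1 *: x) -> gauge_fun K x <= l.
Proof.
move=> l0 Kl; apply: ge_inf; last by split.
by exists 0 => m [/ltW].
Qed.

Lemma gauge_le_scale K p (t : R) : K 0 -> K p -> 0 <= t ->
  gauge_fun K (t *: p) <= t.
Proof.
move=> K0 Kp; rewrite le_eqVlt => /predU1P[<-|t0].
  rewrite scale0r; apply/ler_addgt0Pr => e e0; rewrite add0r.
  by apply: gauge_le => //; rewrite scaler0.
by apply: gauge_le => //; rewrite scalerA mulVf ?gt_eqF// scale1r.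
Qed.

(** Multiples of x tend to 0, an interior point of K. *)
Lemma absorb K x : interior K 0 -> exists2 l : R, 0 < l & K (l^-1 *: x).
Proof.
move=> /nbhs_dist[e e0 h].
exists ((`|x| + 1) / e); first by rewrite divr_gt0// ltr_wpDl.
apply: h; rewrite subr0 normrZ invf_div ger0_norm; last first.
  by rewrite divr_ge0 ?addr_ge0// ltW.
by rewrite mulrAC ltr_pdivrMr ?ltr_wpDl// ltr_pM2l// ltrDl.
Qed.

Lemma le_gauge K x (c : R) : interior K 0 ->
  (forall l, 0 < l -> K (l^-1 *: x) -> c <= l) -> c <= gauge_fun K x.
Proof.
move=> K0 h; apply: lb_le_inf => [|l [l0 Kl]]; last exact: h.
by have [l l0 Kl] := absorb x K0; exists l.
Qed.

Lemma dotv_le_gauge K x v (c : R) : interior K 0 -> 0 < c ->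
  (forall y, K y -> dotv y v <= c) -> dotv x v <= gauge_fun K x * c.
Proof.
move=> K0 c0 h; rewrite -ler_pdivrMr//; apply: le_gauge => // l l0 Kl.
by rewrite ler_pdivrMr// -ler_pdivrMl// -dotvZl h.
Qed.

Lemma norm_le_gauge K : compact K -> interior K 0 ->
  exists2 M : R, 0 < M & forall x, `|x| <= M * gauge_fun K x.
Proof.
move=> /compact_bounded[M [_ hM]] K0; exists (`|M| + 1); first by rewrite ltr_wpDl.
move=> x; rewrite mulrC -ler_pdivrMr ?ltr_wpDl//; apply: le_gauge => // l l0 Kl.
rewrite ler_pdivrMr ?ltr_wpDl//.
have M1 : M < `|M| + 1 by rewrite ltr_pwDr// ler_norm.
have /= := hM _ M1 _ Kl; rewrite normrZ gtr0_norm ?invr_gt0//.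
by rewrite ler_pdivrMl.
Qed.

(** The infimum is a limit of factors l with l^-1 *: x in K, and K is closed. *)
Lemma gauge_attained K x : compact K -> interior K 0 -> x != 0 ->
  K ((gauge_fun K x)^-1 *: x).
Proof.
move=> Kc K0 x0; have Kcl : closed K by apply: compact_closed => //; exact: norm_hausdorff.
have [M M0 hM] := norm_le_gauge Kc K0.
have g0 : 0 < gauge_fun K x.
  by rewrite -(pmulr_rgt0 _ M0); apply: lt_le_trans (hM x); rewrite normr_gt0.
apply: Kcl => B Bg.
have c1 : l^-1 *: x @[l --> gauge_fun K x] --> (gauge_fun K x)^-1 *: x.
  apply: cvgZ; last exact: cvg_cst.
  by apply: cvgV; [rewrite gt_eqF|exact: cvg_id].
have /nbhs_ballP[e /= e0 he] := c1 _ Bg.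
have hi : has_inf [set l : R | 0 < l /\ K (l^-1 *: x)].
  split; last by exists 0 => l [/ltW].
  by have [l l0 Kl] := absorb x K0; exists l.
have [l [l0 Kl] lg] := inf_adherent e0 hi.
exists (l^-1 *: x); split => //; apply: he.
rewrite -ball_normE /= -/(gauge_fun K x) distrC ger0_norm.
  by rewrite ltrBlDl.
by rewrite subr_ge0 gauge_le.
Qed.

Lemma normal_coneP K p v :
  normal_cone K p v <-> forall y, K y -> dotv y v <= dotv p v.
Proof.
by split=> h y Ky; have := h y Ky; rewrite dotvBl subr_le0.
Qed.

Lemma normal_cone_gt0 K p v : interior K 0 -> normal_cone K p v -> v != 0 ->
  0 < dotv p v.
Proof.
move=> K0 /normal_coneP Nv v0; have [l l0 Kl] := absorb v K0.
apply: lt_le_trans (Nv _ Kl).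
by rewrite dotvZl mulr_gt0 ?invr_gt0// dotvv_gt0.
Qed.

Lemma interior_normal_coneZ K p v (t : R) : 0 < t ->
  interior (normal_cone K p) v -> interior (normal_cone K p) (t *: v).
Proof.
move=> t0 Nv; have c1 : t^-1 *: w @[w --> t *: v] --> t^-1 *: (t *: v).
  by apply: (@cvgZ _ _ _ (nbhs (t *: v))); [exact: cvg_cst|exact: cvg_id].
rewrite scalerA mulVf ?gt_eqF// scale1r in c1.
have h : \forall w \near t *: v, normal_cone K p (t^-1 *: w) by exact: (c1 _ Nv).
apply: filterS h => w hw y Ky; have := hw y Ky.
by rewrite dotvZr pmulr_rle0// invr_gt0.
Qed.

(** The gauge of the polar is the support function of K; on the normal cone at p
its maximum is attained at p. *)
Lemma gauge_polar K p v : K p -> normal_cone K p v -> 0 < dotv p v ->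
  gauge_fun (polar K) v = dotv p v.
Proof.
move=> Kp /normal_coneP Nv pv; apply/eqP; rewrite eq_le; apply/andP; split.
  apply: gauge_le => // y Ky.
  by rewrite dotvZl ler_pdivrMl// mulr1 dotvC Nv.
apply: lb_le_inf => [|l [l0 /(_ _ Kp)]].
  exists (dotv p v); split => // y Ky.
  by rewrite dotvZl ler_pdivrMl// mulr1 dotvC Nv.
by rewrite dotvZl ler_pdivrMl// mulr1 dotvC.
Qed.

Lemma near_dotv_differentiable (f : V -> R) p v :
  (\forall w \near v, f w = dotv p w) -> differentiable f v.
Proof.
move=> fp; have lin : linear (dotv p : V -> R^o).
  by move=> a u w; rewrite dotvDr dotvZr.
pose L : {linear V -> R^o} := HB.pack (dotv p : V -> R^o) (GRing.isLinear.Build _ _ _ _ _ lin).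
apply: (@near_linear_differentiable _ _ R^o f L) => // w.
by apply: (@cvg_dotv _ _ (nbhs w)); [exact: cvg_cst|exact: cvg_id].
Qed.

Lemma gauge_polar_near K p v : interior K 0 -> K p ->
  interior (normal_cone K p) v -> v != 0 ->
  \forall w \near v, gauge_fun (polar K) w = dotv p w.
Proof.
move=> K0 Kp Nv v0.
have pv := normal_cone_gt0 K0 (nbhs_singleton Nv) v0.
have c1 : dotv p w @[w --> v] --> dotv p v.
  by apply: (@cvg_dotv _ _ (nbhs v)); [exact: cvg_cst|exact: cvg_id].
have h : \forall w \near v, 0 < dotv p w by exact: (cvgr_gt _ c1).
by apply: filterS2 Nv h => w; exact: gauge_polar.
Qed.

Lemma grad_gauge_polar K p v : interior K 0 -> K p ->
  interior (normal_cone K p) v -> v != 0 -> grad (gauge_fun (polar K)) v = p.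
Proof.
move=> K0 Kp Nv v0; apply/rowP => i; rewrite mxE; apply: sdiff_pderiv.
apply: sdiff_ext (sdiff_dot p v).
by apply: filterS (gauge_polar_near K0 Kp Nv v0) => w ->; rewrite dotvC.
Qed.

Lemma differentiable_gauge_polar K p v : interior K 0 -> K p ->
  interior (normal_cone K p) v -> v != 0 ->
  differentiable (gauge_fun (polar K)) v.
Proof.
move=> K0 Kp Nv v0; apply: near_dotv_differentiable.
exact: gauge_polar_near K0 Kp Nv v0.
Qed.

End Gauge.

(** * Defining functions of the boundary and its normal *)

Section Boundary.
Context {R : realType} {n : nat}.
Local Notation V := 'rV[R]_n.
Implicit Types (x y v e : V) (U : set V) (F : V -> R).

Definition defines U F x :=
  [/\ U x <-> 0 < F x, bdry U x <-> F x = 0 & closure U x <-> 0 <= F x].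

Lemma cvg_ray x v : x + t *: v @[t --> (0:R)^'+] --> x.
Proof.
apply: cvg_at_right_filter.
rewrite -[X in _ --> X](_ : x + 0 *: v = x); last by rewrite scale0r addr0.
apply: cvgD; first exact: cvg_cst.
by apply: cvgZ; [exact: cvg_id|exact: cvg_cst].
Qed.

(** A zero x of F is the limit of the points x + t e, t > 0, of U. *)
Lemma defines_near U F e y : enorm e = 1 ->
  (forall x (t : R), F (x + t *: e) = F x + t) ->
  (\forall x \near y, F z @[z --> x] --> F x) ->
  (\forall x \near y, U x <-> 0 < F x) ->
  \forall x \near y, defines U F x.
Proof.
move=> e1 Fe Fc UF.
apply: filterS3 (UF) (near_join UF) Fc => x Ux Unear Fx.
have pos : 0 < F x -> interior U x.
  move=> F0; have h : \forall z \near x, 0 < F z by exact: (cvgr_gt _ Fx).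
  by apply: filterS2 h Unear => z hz [_]; apply.
have neg : F x < 0 -> ~ closure U x.
  move=> F0 xU; have h : \forall z \near x, F z < 0 by exact: (cvgr_lt _ Fx).
  have [z [Uz [hz [/(_ Uz) Fz _]]]] := xU _ (filterI h Unear).
  by move: (lt_trans Fz hz); rewrite ltxx.
have zero : F x = 0 -> closure U x.
  move=> F0 B Bx.
  have c0 := @cvg_ray x e.
  have h : \forall t \near (0:R)^'+, (B `&` [set z | U z <-> 0 < F z]) (x + t *: e).
    by exact: (c0 _ (filterI Bx Unear)).
  have : \forall t \near (0:R)^'+, B (x + t *: e) /\ U (x + t *: e).
    near=> t; have [] : (B `&` [set z | U z <-> 0 < F z]) (x + t *: e) by near: t.
    move=> h1 /= [_ h2]; split => //; apply: h2; rewrite Fe F0 add0r.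
    by near: t; exact: nbhs_right_gt.
  by move=> /filter_ex[t [h1 h2]]; exists (x + t *: e).
have cl : closure U x <-> 0 <= F x.
  split=> [xU|]; first by rewrite leNgt; apply/negP => /neg.
  by rewrite le_eqVlt => /predU1P[/esym/zero//|/pos/interior_subset/subset_closure].
split=> //; split=> [[/cl F0 nint]|F0].
  apply/eqP; rewrite eq_le F0 andbT leNgt; apply/negP => /pos.
  exact: nint.
split; first by apply/cl; rewrite F0.
by move=> /interior_subset/Ux; rewrite F0 ltxx.
Unshelve. all: by end_near. Qed.

Lemma boundary_equation alpha k U y : 0 <= alpha <= 1 ->
  boundary_class k.+1 alpha U -> bdry U y ->
  exists (F : V -> R) (DF : V -> V) (e : V),
    [/\ enorm e = 1 /\ (forall x (t : R), F (x + t *: e) = F x + t),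
        germ alpha k.+1 y F,
        \forall x \near y, sdiff F x (DF x) /\ dotv e (DF x) = 1 &
        \forall x \near y, defines U F x].
Proof.
move=> a01 Ucl /Ucl[r [e [g [r0 e1 ge gcl Ug]]]].
have ee : dotv e e = 1 by rewrite -sqr_enorm e1 expr1n.
have near_r := eball_nbhs y r0.
have gG : germ alpha k.+1 y g by exact: holder_class_germ gcl.
pose F x := dotv x e - g x.
have FG : germ alpha k.+1 y F by exact: germB (germ_dot _ _ _ _) gG.
have Fe x t : F (x + t *: e) = F x + t.
  by rewrite /F ge dotvDl dotvZl ee mulr1; ring.
have [DF FD _] := FG.
exists F, DF, e; split => //.
  apply: filterS FD => x Fx; split => //.
  have d1 : is_derive (0 : R) (1 : R) (fun t : R => F (x + t *: e)) (dotv e (DF x)).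
    by apply: line_derive; rewrite scale0r addr0; exact: sdiff_derive.
  have d2 : is_derive (0 : R) (1 : R) (fun t : R => F (x + t *: e)) 1.
    rewrite (_ : (fun t : R => _) = cst (F x) + (id : R -> R)).
      by apply: is_derive_eq; rewrite add0r.
    by apply/funext => t; rewrite Fe.
  by case: d1 => _ <-; case: d2.
apply: (defines_near e1) => //.
  by apply: filterS FD => x; exact: sdiff_cvg.
apply: filterS near_r => x /Ug Ux.
by rewrite /F subr_gt0.
Qed.

(** The line x + t tau is pushed back into the boundary along e, by the amount
F (x + t tau), which is o(t) since tau is orthogonal to the gradient. *)
Lemma tangent_vector_of_orthogonal U F e x tau v :
  F x = 0 -> (forall z (t : R), F (z + t *: e) = F z + t) ->
  sdiff F x v -> (\forall z \near x, defines U F z) ->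
  dotv tau v = 0 -> tangent_vector U x tau.
Proof.
move=> Fx0 Fe Fv Ux tv.
pose phi t := F (x + t *: tau).
have dphi : is_derive (0 : R) (1 : R) phi (dotv tau v).
  by apply: line_derive; rewrite scale0r addr0; exact: sdiff_derive.
rewrite tv in dphi; have [dvphi phi0] := dphi.
exists (fun t => x + t *: tau - phi t *: e); split.
- by rewrite scale0r addr0 /phi scale0r addr0 Fx0 scale0r subr0.
- have phic : phi t @[t --> (0:R)] --> 0.
    rewrite -[X in _ --> X](_ : phi 0 = 0); last by rewrite /phi scale0r addr0.
    by apply: differentiable_continuous; apply/derivable1_diffP.
  have c0 : x + t *: tau - phi t *: e @[t --> (0:R)] --> x.
    rewrite -[X in _ --> X](_ : x + 0 *: tau - 0 *: e = x); last first.
      by rewrite !scale0r addr0 subr0.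
    apply: cvgB; last by apply: cvgZ => //; exact: cvg_cst.
    apply: cvgD; first exact: cvg_cst.
    by apply: cvgZ; [exact: cvg_id|exact: cvg_cst].
  have h : \forall t \near (0:R), defines U F (x + t *: tau - phi t *: e) by exact: (c0 _ Ux).
  apply: filterS h => t [_ b _]; apply/b.
  by rewrite -scaleNr Fe /phi subrr.
- have hl : h^-1 *: ((fun t => x + t *: tau - phi t *: e) (h *: (1 : R) + 0) -
      (fun t => x + t *: tau - phi t *: e) 0) @[h --> (0:R)^'] --> tau.
    have h1 : h^-1 *: (phi (h *: (1:R) + 0) - phi 0) @[h --> (0:R)^'] --> 'D_1 phi 0.
      exact: dvphi.
    rewrite phi0 in h1.
    have h2 : tau - (h^-1 *: (phi (h *: (1:R) + 0) - phi 0)) *: e @[h --> (0:R)^'] --> tau.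
      rewrite -[X in _ --> X](_ : tau - (0 : R) *: e = tau); last by rewrite scale0r subr0.
      apply: cvgB; first exact: cvg_cst.
      by apply: cvgZ => //; exact: cvg_cst.
    apply: cvg_trans h2; apply: near_eq_cvg.
    have nz : \forall h \near (0:R)^', h != 0 by exact: nbhs_dnbhs_neq.
    apply: filterS nz => h h0.
    rewrite -[h *: (1:R)]/(h * 1) mulr1 addr0 -[h^-1 *: (phi h - phi 0)]/(h^-1 * (phi h - phi 0)).
    apply/rowP => i; rewrite !mxE.
    by field.
  split; first by apply/cvg_ex; exists tau.
  exact: cvg_lim hl.
Qed.

(** For every w the vector w - <w, v> e is orthogonal to v, hence tangent; so
<w, nu> = <w, v> <e, nu>, and nu is a multiple of v.  It is a positive one
because F increases along nu. *)
Lemma inward_normalE U F e x v nu : F x = 0 ->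
  (forall z (t : R), F (z + t *: e) = F z + t) ->
  sdiff F x v -> dotv e v = 1 -> (\forall z \near x, defines U F z) ->
  inward_unit_normal U x nu -> nu = normalize v.
Proof.
move=> Fx0 Fe Fv ev Ux [nu1 nu_tan nu_in].
have nuE : nu = dotv e nu *: v.
  have nuw w : dotv w nu = dotv w v * dotv e nu.
    apply/eqP; rewrite -subr_eq0 -dotvZl -dotvBl; apply/eqP; apply: nu_tan.
    apply: (tangent_vector_of_orthogonal Fx0 Fe Fv Ux).
    by rewrite dotvBl dotvZl ev mulr1 subrr.
  by apply/rowP => i; rewrite -dotv_delta nuw dotv_delta !mxE mulrC.
have v0 : v != 0.
  by apply/eqP => v0; move: ev; rewrite v0 dotv0 => /eqP; rewrite eq_sym oner_eq0.
have pos : 0 <= dotv nu v.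
  have [W Wv FW] := Fv.
  have c0 := @cvg_ray x nu.
  have c1 : (x + t *: nu, x) @[t --> (0:R)^'+] --> (x, x).
    exact: cvg_pair c0 (cvg_cst _).
  have c2 : dotv nu (W (x + t *: nu, x)) @[t --> (0:R)^'+] --> dotv nu v.
    by apply: cvg_dotv; [exact: cvg_cst|exact: cvg_comp c1 Wv].
  rewrite leNgt; apply/negP => neg.
  have h3 : \forall t \near (0:R)^'+, dotv nu (W (x + t *: nu, x)) < 0.
    exact: (cvgr_lt _ c2).
  have h1 : \forall t \near (0:R)^'+, F (x + t *: nu) - F x =
      dotv (x + t *: nu - x) (W (x + t *: nu, x)) by exact: (c1 _ FW).
  have h2 : \forall t \near (0:R)^'+, defines U F (x + t *: nu) by exact: (c0 _ Ux).
  suff : \forall t \near (0:R)^'+, False by move=> /filter_ex[].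
  near=> t; have t0 : 0 < t by near: t; exact: nbhs_right_gt.
  have Wneg : dotv nu (W (x + t *: nu, x)) < 0 by near: t.
  have : F (x + t *: nu) - F x = dotv (x + t *: nu - x) (W (x + t *: nu, x)) by near: t.
  have [+ _ _] : defines U F (x + t *: nu) by near: t.
  have Ut : U (x + t *: nu) by near: t; exact: nu_in.
  move=> [/(_ Ut) Ft _]; rewrite Fx0 subr0 addrAC subrr add0r dotvZl => E.
  by move: Ft; rewrite E pmulr_rgt0// ltNge (ltW Wneg).
have a0 : 0 <= dotv e nu.
  by move: pos; rewrite {1}nuE dotvZl pmulr_lge0// dotvv_gt0.
move: nu1; rewrite nuE enormZ ger0_norm// => aE.
rewrite /normalize; congr (_ *: _).
by apply: (mulIf (x := enorm v)); rewrite ?gt_eqF ?enorm_gt0// aE mulVf// gt_eqF// enorm_gt0.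
Unshelve. all: by end_near. Qed.

End Boundary.

(** * The anisotropic distance near the boundary *)

Section AnisotropicDistance.
Context {R : realType} {n : nat}.
Local Notation V := 'rV[R]_n.
Implicit Types (x y z v p : V) (K U : set V) (F tau : V -> R).

(** The slope of F between two points of a level set is orthogonal to their
difference.  Adding the difference, which tends to 0, keeps it inside the normal
cone and makes the pairing strictly positive for distinct points. *)
Lemma strict_support K F p y v : interior K 0 -> sdiff F y v ->
  interior (normal_cone K p) v -> v != 0 ->
  \forall q \near (y, y), F q.1 = F q.2 ->
    exists w : V, [/\ normal_cone K p w, 0 < dotv p w &
      dotv (q.2 - q.1) w = dotv (q.2 - q.1) (q.2 - q.1)].
Proof.
move=> K0 [W Wv FW] Nv v0.
have pv := normal_cone_gt0 K0 (nbhs_singleton Nv) v0.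
have wv : W q + (q.2 - q.1) @[q --> (y, y)] --> v.
  rewrite -[X in _ --> X](_ : v + (y - y) = v); last by rewrite subrr addr0.
  apply: cvgD => //; apply: cvgB; [exact: cvg_right cvg_id|exact: cvg_left cvg_id].
have pw : dotv p (W q + (q.2 - q.1)) @[q --> (y, y)] --> dotv p v.
  by apply: cvg_dotv => //; exact: cvg_cst.
have h1 : \forall q \near (y, y), normal_cone K p (W q + (q.2 - q.1)) by exact: (wv _ Nv).
have h2 : \forall q \near (y, y), 0 < dotv p (W q + (q.2 - q.1)) by exact: (cvgr_gt _ pw).
apply: filterS3 h1 h2 FW => q h1 h2 FWq Fq; exists (W q + (q.2 - q.1)); split => //.
move: FWq; rewrite Fq subrr => /esym FWq.
by rewrite dotvDr -[q.2 - q.1]opprB dotvNl FWq oppr0 add0r.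
Qed.

Section Local.
Variables (K U : set V) (F : V -> R) (p y0 v0 : V) (tau : V -> R).
Hypothesis K_compact : compact K.
Hypothesis K0 : interior K 0.
Hypothesis Kp : K p.
Hypothesis Fv0 : sdiff F y0 v0.
Hypothesis Nv0 : interior (normal_cone K p) v0.
Hypothesis v0_neq0 : v0 != 0.
Hypothesis UF : \forall x \near y0, defines U F x.
Hypothesis tau0 : tau y0 = 0.
Hypothesis tau_cvg : tau x @[x --> y0] --> tau y0.
Hypothesis tauF : \forall x \near y0, F (shift_along p tau x) = 0.

Let pr := shift_along p tau.

Let pr_cvg : pr x @[x --> y0] --> y0.
Proof.
by have := cvg_shift (q := p) tau_cvg; rewrite {2}/shift_along tau0 scale0r subr0.
Qed.

Let mono : \forall q \near (y0, y0), forall t : R, q.1 - q.2 = t *: p ->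
  exists2 c, 0 < c & F q.1 - F q.2 = t * c.
Proof.
have pv := normal_cone_gt0 K0 (nbhs_singleton Nv0) v0_neq0.
apply: filterS (sdiff_monotone Fv0 pv) => q h t /h[c c0 E].
by exists c => //; apply: lt_trans c0; rewrite divr_gt0.
Qed.

Let pair_cvg : (x, pr x) @[x --> y0] --> (y0, y0).
Proof. exact: cvg_pair cvg_id pr_cvg. Qed.

Lemma shift_time0 : \forall x \near y0, F x = 0 -> tau x = 0.
Proof.
have h : \forall x \near y0, forall t : R, x - pr x = t *: p ->
    exists2 c, 0 < c & F x - F (pr x) = t * c by exact: (pair_cvg mono).
apply: filterS2 h tauF => x h Fpr Fx.
have [|c c0] := h (tau x); first by rewrite /pr /shift_along opprB addrC subrK.
rewrite Fpr Fx subrr => /esym/eqP; rewrite mulf_eq0 => /orP[/eqP//|].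
by rewrite (gt_eqF c0).
Qed.

Lemma shift_time_ge0 : \forall x \near y0, 0 <= F x -> 0 <= tau x.
Proof.
have h : \forall x \near y0, forall t : R, x - pr x = t *: p ->
    exists2 c, 0 < c & F x - F (pr x) = t * c by exact: (pair_cvg mono).
apply: filterS2 h tauF => x h Fpr Fx.
have [|c c0 E] := h (tau x); first by rewrite /pr /shift_along opprB addrC subrK.
by move: E Fx; rewrite Fpr subr0 => ->; rewrite pmulr_lge0.
Qed.

(** The distance gamma (x - z) is at least tau x for all boundary points z: near y0
by [strict_support], with equality only at pr x, and far from y0 because gamma
dominates the norm while tau x is small. *)
Lemma rho_local : \forall x \near y0, 0 <= F x ->
  rho_fun K U x = tau x /\ unique_closest K U x (pr x).
Proof.
have [e1 e10 supp] := nbhs2_dist (strict_support K0 Fv0 Nv0 v0_neq0).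
have [e2 e20 UFe] := nbhs_dist UF.
pose e := Num.min e1 e2; have e0 : 0 < e by rewrite lt_min e10.
have [M M0 hM] := norm_le_gauge K_compact K0.
have nx : \forall x \near y0, `|x - y0| < e / 2.
  have e2' : 0 < e / 2 by rewrite divr_gt0.
  by apply: filterS (nbhsx_ballx y0 _ e2') => x; rewrite -ball_normE/= distrC.
have npr : \forall x \near y0, `|pr x - y0| < e.
  have h : \forall x \near y0, `|x - y0| < e.
    by apply: filterS nx => x h; apply: lt_trans h _; rewrite gtr_pMr// invf_lt1 ?ltr1n.
  exact: (pr_cvg h).
have ntau : \forall x \near y0, tau x < e / 2 / M.
  by apply: (cvgr_lt _ tau_cvg); rewrite tau0 !divr_gt0.
apply: filterS3 (filterI nx npr) (filterI tauF ntau) shift_time_ge0.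
move=> x [xe pe] [Fpr taux] /[apply] tx.
have prE : x = pr x + tau x *: p by rewrite /pr /shift_along subrK.
have claim z : bdry U z -> tau x <= gauge_fun K (x - z) /\
    (gauge_fun K (x - z) = tau x -> z = pr x).
  move=> zU; have [ze|ze] := ltP `|z - y0| e.
    move: (ze); rewrite lt_min => /andP[ze1 ze2].
    have [_ [/(_ zU) Fz _] _] := UFe z ze2.
    have pe1 : `|pr x - y0| < e1 by move: pe; rewrite lt_min => /andP[].
    have /= := supp z (pr x) ze1 pe1; rewrite Fz Fpr => /(_ erefl).
    move=> [w [/normal_coneP Nw pw E]].
    have := dotv_le_gauge (x - z) K0 pw Nw.
    have -> : x - z = (pr x - z) + tau x *: p by rewrite {1}prE addrAC.
    rewrite dotvDl dotvZl E; set G := gauge_fun _ _ => GE.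
    (* GE reads |pr x - z|^2 + tau x <p, w> <= G <p, w> *)
    have D0 := dotvv_ge0 (pr x - z); split.
      by rewrite -(ler_pM2r pw); apply: le_trans GE; rewrite lerDr.
    move=> Gt; move: GE; rewrite Gt gerDr => D0'.
    have /eqP : dotv (pr x - z) (pr x - z) == 0 by rewrite eq_le D0' D0.
    by move=> /eqP; rewrite dotvv_eq0 subr_eq0 => /eqP.
  have far : e / 2 / M < gauge_fun K (x - z).
    rewrite ltr_pdivrMr// [_ * M]mulrC; apply: lt_le_trans (hM (x - z)).
    have := ler_normB (x - y0) (x - z); rewrite [x - y0 - _]addrC opprB subrKA.
    by lra.
  have lt := lt_trans taux far; split; first exact: ltW.
  by move=> E; move: lt; rewrite E ltxx.
have prU : bdry U (pr x).
  case: (UFe (pr x) _) => [|_ [_ h] _]; last exact: h.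
  by move: pe; rewrite lt_min => /andP[].
have gpr : gauge_fun K (x - pr x) = tau x.
  apply/eqP; rewrite eq_le (claim _ prU).1 andbT.
  rewrite {1}prE addrC addKr; apply: gauge_le_scale => //.
  exact: nbhs_singleton K0.
have rhoE : rho_fun K U x = tau x.
  apply/eqP; rewrite eq_le; apply/andP; split.
    rewrite -gpr; apply: ge_inf; last by exists (pr x).
    by exists 0 => _ [z _ <-]; exact: gauge_ge0.
  apply: lb_le_inf; first by exists (gauge_fun K (x - pr x)), (pr x).
  by move=> _ [z /claim[h _] <-].
split => //; split; first by split => //; rewrite rhoE gpr.
by move=> z [zU]; rewrite rhoE => /esym; exact: (claim z zU).2.
Qed.

(** The point x is taken on the ray y + t p, with one t for all y near y0; the
monotonicity of F along p identifies tau x with t. *)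
Lemma unique_closest_near : \forall y \near y0, bdry U y ->
  exists x, U x /\ unique_closest K U x y.
Proof.
have h : \forall x \near y0, [/\ F (pr x) = 0, defines U F x &
    0 <= F x -> unique_closest K U x (pr x)].
  by apply: filterS3 tauF UF rho_local => x h1 h2 h3; split => // /h3[].
have [e1 e10 h1] := nbhs_dist h.
have [e2 e20 h2] := nbhs2_dist mono.
have [e3 e30 h3] : exists2 e, 0 < e & forall x, `|x - y0| < e -> `|pr x - y0| < e2.
  apply: nbhs_dist.
  have : \forall x \near y0, `|x - y0| < e2.
    by apply: filterS (nbhsx_ballx y0 _ e20) => x; rewrite -ball_normE/= distrC.
  exact: pr_cvg.
pose e := Num.min e1 (Num.min e2 e3).
have e0 : 0 < e by rewrite !lt_min e10 e20.
have lt3 x : `|x - y0| < e -> [/\ `|x - y0| < e1, `|x - y0| < e2 & `|x - y0| < e3].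
  by rewrite !lt_min => /and3P[].
have e2' : 0 < e / 2 by rewrite divr_gt0.
apply: filterS (nbhsx_ballx y0 _ e2') => y; rewrite -ball_normE/= distrC => ye yU.
have p1 : 0 < `|p| + 1 by rewrite ltr_wpDl.
pose t := e / 2 / (`|p| + 1); have t0 : 0 < t by rewrite !divr_gt0.
pose x := y + t *: p.
have ye' : `|y - y0| < e by lra.
have xe : `|x - y0| < e.
  rewrite /x addrAC; apply: le_lt_trans (ler_normD _ _) _.
  rewrite normrZ gtr0_norm// [ltRHS]splitr ltr_leD//.
  apply: (@le_trans _ _ (t * (`|p| + 1))); last by rewrite divfK ?gt_eqF.
  by rewrite ler_pM2l// lerDl.
have [y1 y2 y3] := lt3 _ ye'; have [x1 x2 x3] := lt3 _ xe.
have [_ [_ [/(_ yU) Fy _] _] _] := h1 y y1.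
have [Fpr [[_ Ux] _ _] uniq] := h1 x x1.
have Fx : 0 < F x.
  have [|c c0] := h2 x y x2 y2 t; first by rewrite /x /= addrAC subrr add0r.
  by rewrite /= Fy subr0 => ->; rewrite mulr_gt0.
have tx : tau x = t.
  have [|c c0 /=] := h2 (pr x) y (h3 _ x3) y2 (t - tau x).
    by apply/rowP => i; rewrite /= /pr /shift_along {1}/x !mxE; ring.
  rewrite Fpr Fy subrr => /esym/eqP; rewrite mulf_eq0 subr_eq0 => /orP[/eqP//|].
  by rewrite (gt_eqF c0).
exists x; split; first exact: Ux.
have <- : pr x = y by rewrite /pr /shift_along tx /x addrK.
by apply: uniq; exact: ltW.
Qed.

End Local.
End AnisotropicDistance.

(** * Second derivatives at the boundary *)

Section SecondOrder.
Context {R : realType} {n : nat}.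
Local Notation V := 'rV[R]_n.
Implicit Types (x y z v p : V) (K U : set V) (F g tau : V -> R) (Df Dg : V -> V).

(** On the closure of U the foot point realizes the value g x, and no boundary
point is closer because g is 1-Lipschitz and vanishes on the boundary. *)
Lemma bdry_dist_local U F DF y : F y = 0 -> DF y != 0 ->
  (\forall x \near y, sdiff F x (DF x)) ->
  (forall i, germ 0 1 y (fun x => DF x 0 i)) ->
  (\forall x \near y, defines U F x) ->
  exists (g : V -> R) (Dg : V -> V),
    [/\ \forall x \near y, sdiff g x (Dg x),
        forall i, germ 0 1 y (fun x => Dg x 0 i),
        Dg y = normalize (DF y),
        \forall x \near y, F x = 0 -> g x = 0 &
        \forall x \near y, 0 <= F x -> bdry_dist U x = g x].
Proof.
move=> Fy DF0 FD DFG UF.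
have [g [Dg [foot [gD DgG [Dgy footc] footE g0]]]] := signed_distance Fy DF0 FD DFG.
exists g, Dg; split => //; first by apply: filterS gD => x [].
have gDx : \forall x \near y, sdiff g x (Dg x) by apply: filterS gD => x [].
have gD1 : \forall x \near y, enorm (Dg x) = 1 by apply: filterS gD => x [].
have gy : g y = 0 by exact: (nbhs_singleton g0).
have gc := sdiff_cvg (nbhs_singleton gDx); rewrite gy in gc.
have Dgc : Dg x @[x --> y] --> Dg y.
  by apply: cvg_vec => i; exact: germ_lip (DgG i).
(* x - foot x = g x *: Dg x, and W stays close to DF y, a positive multiple of
   Dg y; hence F x and g x have the same sign *)
have [W Wv FW] := nbhs_singleton FD.
have pc : (x, foot x) @[x --> y] --> (y, y) by exact: cvg_pair cvg_id footc.
have WD : \forall x \near y, 0 < dotv (Dg x) (W (x, foot x)).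
  have c1 : dotv (Dg x) (W (x, foot x)) @[x --> y] --> dotv (Dg y) (DF y).
    by apply: (@cvg_dotv _ _ (nbhs y)) => //; exact: cvg_comp pc Wv.
  apply: (cvgr_gt _ c1).
  by rewrite Dgy dotvZl mulr_gt0 ?invr_gt0 ?enorm_gt0 ?dotvv_gt0.
have FWx : \forall x \near y, F x - F (foot x) = dotv (x - foot x) (W (x, foot x)).
  exact: (pc _ FW).
have sgn : \forall x \near y, 0 <= F x -> 0 <= g x.
  apply: filterS3 footE WD FWx => x [Ff fE] wx; rewrite Ff subr0 => ->.
  by rewrite {1}fE addrC addKr dotvZl pmulr_lge0.
have footU : \forall x \near y, defines U F (foot x) by exact: (footc _ UF).
(* since |Dg| = 1, a mean value of g between x and a boundary point z bounds
   g x = g x - g z by the length of x - z *)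
have [e1 e10 low] := nbhs2_dist (sdiff_mvt gDx gD1).
have [e2 e20 h2] := nbhs_dist (filterI UF g0).
pose e := Num.min e1 e2; have e0 : 0 < e by rewrite lt_min e10.
have e2' : 0 < e / 2 by rewrite divr_gt0.
have nx : \forall x \near y, `|x - y| < e / 2.
  by apply: filterS (nbhsx_ballx y _ e2') => x; rewrite -ball_normE/= distrC.
have ng : \forall x \near y, g x < e / 2 by exact: (cvgr_lt _ gc).
apply: filterS3 (filterI footE footU) (filterI (filterI nx ng) gD1) sgn.
move=> x [[Ff fE] [_ [_ /(_ Ff) fU] _]] [[xe gx] Dg1] /[apply] gx0.
apply/eqP; rewrite eq_le; apply/andP; split.
  apply: (@le_trans _ _ (enorm (x - foot x))).
    apply: ge_inf; last by exists (foot x).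
    by exists 0 => _ [z _ <-]; exact: enorm_ge0.
  rewrite {1}fE [foot x + _]addrC addrK enormZ Dg1 mulr1 ger0_norm//.
apply: lb_le_inf; first by exists (enorm (x - foot x)), (foot x).
move=> _ [z zU <-]; have [ze|ze] := ltP `|z - y| e.
  move: (ze); rewrite lt_min => /andP[ze1 ze2].
  have [[_ [/(_ zU) Fz _] _] /(_ Fz) gz] := h2 z ze2.
  have xe1 : `|x - y| < e1.
    by apply: lt_le_trans (_ : e <= e1); [lra|rewrite ge_min lexx].
  have [w w1 /=] := low x z xe1 ze1.
  by rewrite gz subr0 => ->; exact: dotv_le_unit.
apply: le_trans (norm_le_enorm _).
have := ler_normB (x - y) (x - z); rewrite [x - y - _]addrC opprB subrKA.
by lra.
Qed.

Lemma hessE f Df (D2 : 'I_n -> V) y :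
  (\forall x \near y, sdiff f x (Df x)) ->
  (forall i, sdiff (fun x => Df x 0 i) y (D2 i)) ->
  hess f y = \matrix_(i < n, j < n) D2 i 0 j.
Proof.
move=> fD D2f; apply/matrixP => i j; rewrite !mxE; apply: sdiff_pderiv.
apply: sdiff_ext (D2f i); apply: filterS fD => x fx.
by rewrite (sdiff_pderiv i fx).
Qed.

(** That g vanishes at all points pr x = x - tau x *: p means that
Dg (pr x) = <p, Dg (pr x)> *: Dtau x.  Differentiating both sides at y, where
pr y = y, determines the derivative of Dtau. *)
Lemma hess_shift g Dg tau Dtau p y : tau y = 0 ->
  (\forall x \near y, sdiff g x (Dg x)) ->
  (forall i, germ 0 1 y (fun x => Dg x 0 i)) ->
  (\forall x \near y, sdiff tau x (Dtau x)) ->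
  (forall i, germ 0 1 y (fun x => Dtau x 0 i)) ->
  (\forall x \near y, g (shift_along p tau x) = 0) ->
  dotv p (Dg y) != 0 ->
  let X := (dotv p (Dg y))^-1 *: tensor p (Dg y) in
  hess tau y = (dotv p (Dg y))^-1 *: ((1%:M - X^T) *m hess g y *m (1%:M - X)).
Proof.
move=> tauy gD DgG tauD DtauG g0 s0 X.
set s := dotv p (Dg y) in s0 X *.
pose pr := shift_along p tau.
have pry : pr y = y by rewrite /pr /shift_along tauy scale0r subr0.
have /choice[H hH] : forall i, exists v, sdiff (fun x => Dg x 0 i) y v.
  by move=> i; have [D /nbhs_singleton Dy _] := DgG i; exists (D y).
have /choice[T hT] : forall i, exists v, sdiff (fun x => Dtau x 0 i) y v.
  by move=> i; have [D /nbhs_singleton Dy _] := DtauG i; exists (D y).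
rewrite (hessE gD hH) (hessE tauD hT).
have tauDy := nbhs_singleton tauD.
have prc : pr x @[x --> y] --> y.
  rewrite -[X in _ --> X]pry; apply: cvg_vec => i.
  exact: sdiff_lip (sdiff_shift p i tauDy).
have prD m := sdiff_shift p m tauDy.
have gDpr : \forall x \near y, sdiff g (pr x) (Dg (pr x)) by exact: (prc _ gD).
(* the differential of g (pr x) = 0 *)
have id1 : \forall x \near y, Dg (pr x) = dotv p (Dg (pr x)) *: Dtau x.
  apply: filterS3 (near_join g0) tauD gDpr => x gx tx gprx.
  have /sdiff_uniq := sdiff_comp gprx (fun m => sdiff_shift p m tx).
  move=> /(_ 0) E; apply/eqP; rewrite -subr_eq0 -[X in _ == X]E; last first.
    by apply: sdiff_ext (sdiff_cst 0 x); apply: filterS gx => z ->.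
  apply/eqP/rowP => j; rewrite summxE !mxE [dotv _ _]/dotv mulr_suml.
  rewrite [X in _ = X](eq_bigr (fun m => Dg (pr x) 0 m * (m == j)%:R -
     p 0 m * Dg (pr x) 0 m * Dtau x 0 j)); last first.
    by move=> m _; rewrite !mxE eqxx/= [j == m]eq_sym; ring.
  rewrite sumrB; congr (_ - _); rewrite (bigD1 j)//= eqxx mulr1.
  by rewrite big1 ?addr0// => m /negbTE ->; rewrite mulr0.
have Dtauy : Dtau y = s^-1 *: Dg y.
  have := nbhs_singleton id1; rewrite pry -/s => E.
  by rewrite E scalerA mulVf// scale1r.
pose u i : V := \sum_m H i 0 m *: (delta_mx 0 m - p 0 m *: Dtau y).
have hu i : sdiff (fun x => Dg (pr x) 0 i) y (u i).
  apply: (@sdiff_comp _ _ _ (fun z => Dg z 0 i)) => //.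
  by rewrite pry.
have hT2 i : T i = s^-1 *: (u i - Dtau y 0 i *: \sum_l p 0 l *: u l).
  have h1 : sdiff (fun x => (\sum_l p 0 l * Dg (pr x) 0 l) * Dtau x 0 i) y (u i).
    apply: sdiff_ext (hu i); apply: filterS id1 => x E.
    by rewrite {1}E mxE.
  have h2 := sdiffM (sdiff_sum (index_enum _) (P := xpredT)
    (fun l _ => sdiffZ (p 0 l) (hu l))) (hT i).
  have := sdiff_uniq h1 h2; rewrite pry -/(dotv p (Dg y)) -/s => ->.
  by rewrite addrK scalerA mulVf// scale1r.
pose A := (\matrix_(i, j) H i 0 j) *m (1%:M - X) : 'M[R]_n.
have uA i j : u i 0 j = A i j.
  rewrite summxE mxE; apply: eq_bigr => m _.
  by rewrite !mxE Dtauy big_ord1 !mxE eqxx/= [j == m]eq_sym; ring.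
apply/matrixP => i j; rewrite -mulmxA -/A mulmxBl mul1mx !mxE hT2 !mxE uA.
congr (_ * (_ - _)); first by rewrite mxE.
rewrite summxE mulr_sumr; apply: eq_bigr => l _.
by rewrite !mxE big_ord1 !mxE uA Dtauy !mxE; ring.
Qed.

End SecondOrder.

(** * Regularity of the anisotropic distance *)

Lemma extension_of_germ (R : realType) (n j : nat) (alpha : R) (U : set 'rV[R]_n)
    (f h : 'rV[R]_n -> R) (y : 'rV[R]_n) : 0 <= alpha <= 1 -> germ alpha j y h ->
  (\forall x \near y, closure U x -> f x = h x) ->
  \forall r \near (0:R)^'+, [/\ 0 < r, holder_class j alpha (eball y r) h &
    forall x, closure U x -> eball y r x -> h x = f x].
Proof.
move=> a01 hG fh; have h1 := germ_holder_class a01 hG.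
have h2 := eball_sub_near fh.
near=> r; split; first by near: r; exact: nbhs_right_gt.
  by near: r.
move=> x Ux yx; apply/esym; move: Ux; move: x yx.
by near: r.
Unshelve. all: by end_near. Qed.

Theorem theorem2 (R : realType) (n : nat) (K U : set 'rV[R]_n)
    (k : nat) (alpha : R) (nu : 'rV[R]_n -> 'rV[R]_n) (x0 y0 : 'rV[R]_n)
    (K_compact : compact K) (K_convex : convex_set K)
    (K_int0 : interior K 0)
    (U_bounded : bounded_set U) (U_open : open U)
    (k_ge1 : (1 <= k)%N) (alpha_ge0 : 0 <= alpha) (alpha_le1 : alpha <= 1)
    (U_class : boundary_class k alpha U)
    (nu_normal : forall y, bdry U y -> inward_unit_normal U y (nu y))
    (y0_bdry : bdry U y0) (x0_U : U x0)
    (y0_closest : unique_closest K U x0 y0)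
    (nu0_int : interior (normal_cone K ((rho_fun K U x0)^-1 *: (x0 - y0))) (nu y0)) :
  exists r : R,
    [/\ 0 < r,
        holder_class_closure k alpha U (eball y0 r) (rho_fun K U),
        forall y, bdry U y -> eball y0 r y ->
          exists x, U x /\ unique_closest K U x y,
        forall y, bdry U y -> eball y0 r y ->
          is_inner_grad U (rho_fun K U) y
            ((gauge_fun (polar K) (nu y))^-1 *: nu y) &
        (2 <= k)%N ->
        forall y, bdry U y -> eball y0 r y ->
          differentiable (gauge_fun (polar K)) (nu y) /\
          exists D2d : 'M[R]_n,
            is_inner_hess U (bdry_dist U) y D2d /\
            is_inner_hess U (rho_fun K U) y
              ((gauge_fun (polar K) (nu y))^-1 *:
                 ((1%:M - (Xmat K (nu y))^T) *m D2d
                    *m (1%:M - Xmat K (nu y))))].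
Proof.
case: k k_ge1 U_class => // k _ U_class.
have a01 : 0 <= alpha <= 1 by rewrite alpha_ge0.
have z01 : 0 <= (0 : R) <= 1 by rewrite lexx ler01.
have [F [DF [e [[e1 Fe] FG FDe UF]]]] := boundary_equation a01 U_class y0_bdry.
have FD : \forall x \near y0, sdiff F x (DF x) by apply: filterS FDe => x [].
have DFG i : germ alpha k y0 (fun x => DF x 0 i) by exact: germ_grad FG FD.
have Fy0 : F y0 = 0 by have [_ [h _] _] := nbhs_singleton UF; exact: h.
have nuE : \forall y \near y0, bdry U y -> nu y = normalize (DF y).
  apply: filterS3 FDe UF (near_join UF) => y [Fy ey] [_ [b _] _] Uy yU.
  exact: inward_normalE (b yU) Fe Fy ey Uy (nu_normal y yU).
have DF0 : \forall y \near y0, DF y != 0.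
  apply: filterS FDe => y [_ ey]; apply/eqP => E.
  by move: ey; rewrite E dotv0 => /eqP; rewrite eq_sym oner_eq0.
have DF0y := nbhs_singleton DF0.
(* the point of K whose normal cone has nu y0 in its interior: near y0 it is
   the direction of every shortest ray from the boundary *)
pose p := (rho_fun K U x0)^-1 *: (x0 - y0).
have Kp : K p.
  have [[_ rho0] _] := y0_closest; rewrite /p rho0; apply: gauge_attained => //.
  rewrite subr_eq0; apply/eqP => E; case: y0_bdry => _; apply.
  by rewrite -E; exact: open_nbhs_nbhs.
have Nu_DF v : v != 0 -> interior (normal_cone K p) (normalize v) <->
    interior (normal_cone K p) v.
  rewrite -enorm_gt0 => v0; split => [/(interior_normal_coneZ v0)|].
    by rewrite scalerA mulfV ?gt_eqF// scale1r.
  by apply: interior_normal_coneZ; rewrite invr_gt0.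
have NDF0 : interior (normal_cone K p) (DF y0).
  by apply/Nu_DF => //; rewrite -(nbhs_singleton nuE).
have pDF0 := normal_cone_gt0 K_int0 (nbhs_singleton NDF0) DF0y.
have DFc : DF x @[x --> y0] --> DF y0.
  apply: (@cvg_mx _ _ (nbhs y0) _) => i j; rewrite ord1.
  exact: germ_cvg (DFG j).
have [tau [tau0 tauF tauD]] := implicit_shift Fy0 FD DFc pDF0.
have tauG : germ alpha k.+1 y0 tau by exact: germ_implicit tauD.
have FDy0 := nbhs_singleton FD.
have tauc := sdiff_cvg (nbhs_singleton tauD).
have rhoE := rho_local K_compact K_int0 Kp FDy0 NDF0 DF0y UF tau0 tauc tauF.
have uniq := unique_closest_near K_compact K_int0 Kp FDy0 NDF0 DF0y UF tau0 tauc tauF.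
have tau00 := shift_time0 K_int0 FDy0 NDF0 DF0y tau0 tauc tauF.
have rho_cl : \forall x \near y0, closure U x -> rho_fun K U x = tau x.
  by apply: filterS2 UF rhoE => x [_ _ [h _]] r /h/r[].
have NDF : \forall y \near y0, interior (normal_cone K p) (DF y).
  exact: (DFc _ (nbhs_interior NDF0)).
have nuN : \forall y \near y0, bdry U y ->
    [/\ nu y = normalize (DF y), interior (normal_cone K p) (nu y) & nu y != 0].
  apply: filterS3 nuE DF0 NDF => y nuy DFy Ny /nuy ->; split => //; first exact/Nu_DF.
  by rewrite -enorm_gt0 enorm_normalize.
have polarE y : interior (normal_cone K p) (nu y) -> nu y != 0 ->
    gauge_fun (polar K) (nu y) = dotv p (nu y) /\ 0 < dotv p (nu y).
  move=> Ny ny; have pn := normal_cone_gt0 K_int0 (nbhs_singleton Ny) ny.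
  by split => //; exact: gauge_polar (nbhs_singleton Ny) pn.
have rho_grad : \forall y \near y0, bdry U y -> is_inner_grad U (rho_fun K U) y
    ((gauge_fun (polar K) (nu y))^-1 *: nu y).
  (* at a boundary point y the shift time vanishes, and the gradient of tau is
     DF y / <p, DF y>, a quotient that does not change when DF y is normalized *)
  have tau1 : \forall y \near y0, germ 0 1 y tau.
    apply: germ_near; apply: (@germ_exponent0 _ _ alpha).
    exact: germ_le tauG.
  apply: filterS3 (filterI (near_join rho_cl) tau1) (filterI nuN tau00) (filterI tauD UF).
  move=> y [rho_y tau_y] [nuy ty] [tDy [_ [b _] _]] yU.
  have [nE Ny ny] := nuy yU; have [gE gp] := polarE y Ny ny.
  have tauy : tau y = 0 by exact: ty (b yU).
  have /filter_ex[r [r0 h1 h2]] := extension_of_germ z01 tau_y rho_y.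
  exists r, tau; split => //; apply/rowP => i; rewrite mxE (sdiff_pderiv i tDy).
  have -> : shift_along p tau y = y by rewrite /shift_along tauy scale0r subr0.
  rewrite gE nE /normalize dotvZr !mxE.
  have DFy : enorm (DF y) != 0.
    rewrite gt_eqF// enorm_gt0; apply/eqP => E.
    by move: gp; rewrite nE E /normalize scaler0 dotv0 ltxx.
  have pDFy : dotv p (DF y) != 0.
    by apply/eqP => E; move: gp; rewrite nE dotvZr E mulr0 ltxx.
  by field; rewrite DFy pDFy.
have rho_hess : (2 <= k.+1)%N -> \forall y \near y0, bdry U y ->
    differentiable (gauge_fun (polar K)) (nu y) /\
    exists D2d : 'M[R]_n, is_inner_hess U (bdry_dist U) y D2d /\
      is_inner_hess U (rho_fun K U) y
        ((gauge_fun (polar K) (nu y))^-1 *: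
           ((1%:M - (Xmat K (nu y))^T) *m D2d *m (1%:M - Xmat K (nu y)))).
  move=> k2.
  (* the signed distance g is built at each boundary point y near y0, with its
     own normal direction, whereas tau always belongs to p *)
  have tau2 : \forall y \near y0, germ 0 2 y tau.
    by apply: germ_near; apply: (@germ_exponent0 _ _ alpha); exact: germ_le tauG.
  have DF1 : \forall y \near y0, forall i, germ 0 1 y (fun x => DF x 0 i).
    have DF1i i : \forall y \near y0, germ 0 1 y (fun x => DF x 0 i).
      by apply: germ_near; apply: (@germ_exponent0 _ _ alpha); exact: germ_le (DFG i).
    exact: (@filter_forall _ _ _ (nbhs y0) _ DF1i).
  apply: filterS3 (filterI (filterI (near_join rho_cl) (near_join UF)) (filterI tau2 DF1))
    (filterI (filterI nuN tau00) (filterI (near_join tauD) (near_join tauF)))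
    (filterI (near_join FD) DF0).
  move=> y [[rho_y UFy] [tau_y DF_y]] [[nuy ty] [tDy tFy]] [FDy DF0'] yU.
  have [nE Ny ny] := nuy yU; have [gE gp] := polarE y Ny ny.
  have [_ [/(_ yU) Fy _] _] := nbhs_singleton UFy.
  have tauy : tau y = 0 by exact: ty.
  split; first exact: differentiable_gauge_polar Ny ny.
  have [g [Dg [gD DgG Dgy g0 dE]]] := bdry_dist_local Fy DF0' FDy DF_y UFy.
  have gG : germ 0 2 y g by exists Dg.
  exists (hess g y); split.
    have d_cl : \forall x \near y, closure U x -> bdry_dist U x = g x.
      by apply: filterS2 UFy dE => x [_ _ [h _]] d /h/d.
    have /filter_ex[r [r0 h1 h2]] := extension_of_germ z01 gG d_cl.
    by exists r, g.
  have /filter_ex[r [r0 h1 h2]] := extension_of_germ z01 tau_y rho_y.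
  exists r, tau; split => //.
  have shc : shift_along p tau x @[x --> y] --> y.
    rewrite -[X in _ --> X](_ : shift_along p tau y = y).
      by apply: cvg_shift; exact: sdiff_cvg (nbhs_singleton tDy).
    by rewrite /shift_along tauy scale0r subr0.
  have gpr : \forall x \near y, g (shift_along p tau x) = 0.
    have h : \forall x \near y, F (shift_along p tau x) = 0 ->
      g (shift_along p tau x) = 0 by exact: (shc _ g0).
    by apply: filterS2 tFy h => x Fx; apply.
  rewrite (hess_shift tauy gD DgG tDy _ gpr); last first.
  - by rewrite Dgy -nE gt_eqF.
  - by move=> i; exact: germ_grad tau_y tDy.
  by rewrite Dgy -nE /Xmat (grad_gauge_polar K_int0 Kp Ny ny) gE.
have rho_hess' : \forall y \near y0, (2 <= k.+1)%N -> bdry U y ->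
    differentiable (gauge_fun (polar K)) (nu y) /\
    exists D2d : 'M[R]_n, is_inner_hess U (bdry_dist U) y D2d /\
      is_inner_hess U (rho_fun K U) y
        ((gauge_fun (polar K) (nu y))^-1 *:
           ((1%:M - (Xmat K (nu y))^T) *m D2d *m (1%:M - Xmat K (nu y)))).
  have [/rho_hess|k2] := boolP (2 <= k.+1)%N; first by apply: filterS => y h _.
  by apply: near1W => y h.
have ext := extension_of_germ a01 tauG rho_cl.
have uniq_r := eball_sub_near uniq; have grad_r := eball_sub_near rho_grad.
have hess_r := eball_sub_near rho_hess'.
near ((0:R)^'+) => r.
have [r0 tau_r rho_r] : [/\ 0 < r, holder_class k.+1 alpha (eball y0 r) tau &
  forall x, closure U x -> eball y0 r x -> tau x = rho_fun K U x] by near: r.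
exists r; split => //.
- by exists tau.
- by move=> y yU yr; move: yU; move: y yr; near: r.
- by move=> y yU yr; move: yU; move: y yr; near: r.
- by move=> k2 y yU yr; move: k2 yU; move: y yr; near: r.
Unshelve. all: by end_near. Qed.
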